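(* Let $k\in\frac12\mathbb{Z}$ and let $f:\mathbb{H}\to\mathbb{C}^m$ be given by an absolutely convergent series \[f(\tau)=\sum_{j=1}^m\sum_{n\gg-\infty}c^+_{f,j}(n)e^{2\pi i(n+\kappa_j)\tau}\mathbf{e}_j+\sum_{j=1}^m\sum_{n+\kappa_j<0}c^-_{f,j}(n)\Gamma(1-k,-4\pi(n+\kappa_j)v)e^{2\pi i(n+\kappa_j)\tau}\mathbf{e}_j\] ($\tau=u+iv$). Then: \begin{enumerate} \item for every $\varphi\in\mathcal{F}_f$, $L_f(\varphi)=\int_0^\infty f(iy)\varphi(y)\,dy$; \item for every $\varphi\in\mathcal{F}_{\delta_kf}$, $L_{\delta_kf}(\varphi)=\int_0^\infty(\delta_kf)(iy)\varphi(y)\,dy$. \end{enumerate}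
   Context: $\mathbf{e}_1,\dots,\mathbf{e}_m$ is the standard basis of $\mathbb{C}^m$, $\kappa_1,\dots,\kappa_m\in[0,1)$ are fixed, and $\Gamma(a,w)$ is the (analytically continued) incomplete gamma function $\int_w^\infty e^{-t}t^{a-1}dt$. Let $n_0\in\mathbb{N}$ be such that $f_j(\tau)=O(e^{2\pi n_0v})$ as $v\to\infty$ for each $j$. $\mathcal{L}$ is the Laplace transform $(\mathcal{L}\varphi)(s)=\int_0^\infty e^{-st}\varphi(t)dt$, and for a function $\varphi$ and $s\in\mathbb{C}$, $\varphi_s(x):=\varphi(x)x^{s-1}$. All test functions are piecewise smooth complex-valued functions. $\mathcal{F}_f$ is the space of $\varphi$ such that (i) $(\mathcal{L}\varphi)(s)$ converges absolutely for $\mathrm{Re}(s)\ge-2\pi n_0$; (ii) $(\mathcal{L}\varphi_{2-k})(s)$ converges absolutely for $\mathrm{Re}(s)>0$; (iii) for each $j$, $\sum_n|c^+_{f,j}(n)|(\mathcal{L}|\varphi|)(2\pi(n+\kappa_j))+\sum_{n+\kappa_j<0}|c^-_{f,j}(n)|(4\pi|n+\kappa_j|)^{1-k}\int_0^\infty\frac{(\mathcal{L}|\varphi_{2-k}|)(-2\pi(n+\kappa_j)(2t+1))}{(1+t)^k}dt$ converges. For $\varphi\in\mathcal{F}_f$, \[L_f(\varphi):=\sum_{j}\sum_nc^+_{f,j}(n)(\mathcal{L}\varphi)(2\pi(n+\kappa_j))\mathbf{e}_j+\sum_j\sum_{n+\kappa_j<0}c^-_{f,j}(n)(-4\pi(n+\kappa_j))^{1-k}\int_0^\infty\frac{(\mathcal{L}\varphi_{2-k})(-2\pi(n+\kappa_j)(2t+1))}{(1+t)^k}dt\,\mathbf{e}_j.\]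 Define $(\delta_kf)(\tau):=\tau\frac{\partial f}{\partial u}(\tau)+\frac k2f(\tau)$. $\mathcal{F}_{\delta_kf}$ is the space of $\varphi$ such that (i) $(\mathcal{L}\varphi)(s)$ converges absolutely for $\mathrm{Re}(s)\ge-2\pi n_0$; (ii) $(\mathcal{L}\varphi_{3-k})(s)$ converges absolutely for $\mathrm{Re}(s)>0$; (iii) for each $j$, $\sum_n|c^+_{f,j}(n)(n+\kappa_j)|(\mathcal{L}|\varphi_2|)(2\pi(n+\kappa_j))+\sum_{n+\kappa_j<0}|c^-_{f,j}(n)(n+\kappa_j)|(4\pi|n+\kappa_j|)^{1-k}\int_0^\infty\frac{(\mathcal{L}|\varphi_{3-k}|)(-2\pi(n+\kappa_j)(2t+1))}{(1+t)^k}dt$ converges. For $\varphi\in\mathcal{F}_{\delta_kf}$, \[L_{\delta_kf}(\varphi):=\tfrac k2L_f(\varphi)-2\pi\sum_j\sum_nc^+_{f,j}(n)(n+\kappa_j)(\mathcal{L}\varphi_2)(2\pi(n+\kappa_j))\mathbf{e}_j-2\pi\sum_j\sum_{n+\kappa_j<0}c^-_{f,j}(n)(n+\kappa_j)(-4\pi(n+\kappa_j))^{1-k}\int_0^\infty\frac{(\mathcal{L}\varphi_{3-k})(-2\pi(n+\kappa_j)(2t+1))}{(1+t)^k}dt\,\mathbf{e}_j.\]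
   Formalization: In part 2, when k ≠ 0, φ is also assumed to lie in F_f, since L_{δ_k f}(φ) contains (k/2)L_f(φ), which is defined only for φ in F_f, and F_{δ_k f} is not contained in F_f (both sides can diverge otherwise). *)

(* Defs.v *)
From HB Require Import structures.
From mathcomp Require Import all_boot all_order all_algebra.
From mathcomp Require Import all_classical all_reals all_analysis.
From mathcomp Require Import complex.

Set Implicit Arguments.
Unset Strict Implicit.
Unset Printing Implicit Defensive.

Import Order.TTheory GRing.Theory Num.Theory.
Import numFieldNormedType.Exports.
Import Normc.

Local Open Scope classical_set_scope.
Local Open Scope ring_scope.
Local Open Scope complex_scope.

Definition cexp (R : realType) (z : R[i]) : R[i] :=
  (expR (complex.Re z) * cos (complex.Im z))
    +i* (expR (complex.Re z) * sin (complex.Im z)).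

Definition posreal (R : realType) : set R := `]0, +oo[%classic.

(* Integral of a complex-valued function, by real and imaginary parts. *)
Definition cint (R : realType) (D : set R) (g : R -> R[i]) : R[i] :=
  Rintegral lebesgue_measure D (fun x => complex.Re (g x))
    +i* Rintegral lebesgue_measure D (fun x => complex.Im (g x)).

(* Absolute convergence of the integral of g over D. *)
Definition cintegrable (R : realType) (D : set R) (g : R -> R[i]) : Prop :=
  [/\ measurable_fun D (fun x => complex.Re (g x)),
      measurable_fun D (fun x => complex.Im (g x)) &
      (\int[lebesgue_measure]_(x in D) (normc (g x))%:E < +oo)%E].

(* Unordered sums over a set of integers; the value is meaningful only for
   absolutely convergent families. *)
Definition rsum (R : realType) (D : set int) (F : int -> R) : R :=
  fine (\esum_(n in D) (Num.max (F n) 0)%:E)%E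
    - fine (\esum_(n in D) (Num.max (- F n) 0)%:E)%E.

Definition csum (R : realType) (D : set int) (F : int -> R[i]) : R[i] :=
  rsum D (fun n => complex.Re (F n)) +i* rsum D (fun n => complex.Im (F n)).

Definition csummable (R : realType) (D : set int) (F : int -> R[i]) : Prop :=
  (\esum_(n in D) (normc (F n))%:E < +oo)%E.

(* Only needed for w > 0, where the integral converges for every real a and so
   agrees with the analytic continuation. *)
Definition inc_gamma (R : realType) (a w : R) : R :=
  Rintegral lebesgue_measure `]w, +oo[%classic
    (fun t => expR (- t) * t `^ (a - 1)).

Definition laplace (R : realType) (phi : R -> R[i]) (s : R[i]) : R[i] :=
  cint (@posreal R) (fun t => cexp (- (s * t%:C)) * phi t).

Definition laplace_abscvg (R : realType) (phi : R -> R[i]) (s : R[i]) : Prop :=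
  cintegrable (@posreal R) (fun t => cexp (- (s * t%:C)) * phi t).

(* (L|phi|)(s) at a real point s, possibly +oo. *)
Definition laplace_norm (R : realType) (phi : R -> R[i]) (s : R) : \bar R :=
  (\int[lebesgue_measure]_(t in @posreal R)
     (expR (- (s * t)) * normc (phi t))%:E)%E.

(* phi_s(x) = phi(x) x^(s-1); only real s are needed. *)
Definition twist (R : realType) (phi : R -> R[i]) (s : R) : R -> R[i] :=
  fun x => phi x * (x `^ (s - 1))%:C.

(* g is smooth on (0,oo) away from a set S of breakpoints that is locally
   finite in (0,oo), and all its derivatives have finite one-sided limits at
   the breakpoints. *)
Definition piecewise_smooth_real (R : realType) (g : R -> R) : Prop :=
  exists S : set R,
    [/\ forall a b : R, 0 < a -> finite_set (S `&` `[a, b]%classic),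
        forall (x : R) (p : nat), 0 < x -> ~ S x -> derivable (derive1n p g) x 1 &
        forall (x : R) (p : nat), 0 < x -> S x ->
          cvg (derive1n p g y @[y --> x^'+]) /\ cvg (derive1n p g y @[y --> x^'-])].

Definition piecewise_smooth (R : realType) (phi : R -> R[i]) : Prop :=
  piecewise_smooth_real (fun x => complex.Re (phi x)) /\
  piecewise_smooth_real (fun x => complex.Im (phi x)).

Definition freq (R : realType) (kap : R) (n : int) : R := n%:~R + kap.

Definition negfreq (R : realType) (kap : R) : set int :=
  [set n | freq kap n < 0].

Section Series.
Context (R : realType) (m : nat) (k : R) (kap : 'I_m -> R) (n0 : nat).
Context (cp cm : 'I_m -> int -> R[i]).

Definition plus_term (j : 'I_m) (tau : R[i]) (n : int) : R[i] :=
  cp j n * cexp ((0 +i* 1) * (2 * pi * freq (kap j) n)%:C * tau).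

Definition minus_term (j : 'I_m) (tau : R[i]) (n : int) : R[i] :=
  cm j n * (inc_gamma (1 - k) (- (4 * pi * freq (kap j) n * complex.Im tau)))%:C
    * cexp ((0 +i* 1) * (2 * pi * freq (kap j) n)%:C * tau).

Definition has_expansion (f : R[i] -> 'rV[R[i]]_m) : Prop :=
  (exists N : int, forall (j : 'I_m) (n : int), n < N -> cp j n = 0) /\
  forall tau : R[i], 0 < complex.Im tau ->
    (forall j : 'I_m, csummable setT (plus_term j tau) /\
                      csummable (negfreq (kap j)) (minus_term j tau)) /\
    f tau = \row_j (csum setT (plus_term j tau)
                    + csum (negfreq (kap j)) (minus_term j tau)).

(* f_j(tau) = O(e^(2 pi n0 v)) as v -> oo, uniformly in u. *)
Definition growth_bound (f : R[i] -> 'rV[R[i]]_m) : Prop :=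
  forall j : 'I_m, exists A V : R, forall u v : R, 0 < v -> V <= v ->
    normc (f (u +i* v) ord0 j) <= A * expR (2 * pi * n0%:R * v).

Definition F_f (phi : R -> R[i]) : Prop :=
  [/\ piecewise_smooth phi,
      forall s : R[i], - (2 * pi * n0%:R) <= complex.Re s -> laplace_abscvg phi s,
      forall s : R[i], 0 < complex.Re s -> laplace_abscvg (twist phi (2 - k)) s &
      forall j : 'I_m,
        (\esum_(n in [set: int])
            ((normc (cp j n))%:E * laplace_norm phi (2 * pi * freq (kap j) n))
         + \esum_(n in negfreq (kap j))
            ((normc (cm j n) * (4 * pi * `|freq (kap j) n|) `^ (1 - k))%R%:E *
             \int[lebesgue_measure]_(t in @posreal R)
               (laplace_norm (twist phi (2 - k))
                  (- (2 * pi * freq (kap j) n * (2 * t + 1)))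
                * (((1 + t) `^ k)^-1)%R%:E))
         < +oo)%E].

Definition L_f (phi : R -> R[i]) : 'rV[R[i]]_m :=
  \row_j
    (csum setT (fun n => cp j n * laplace phi (2 * pi * freq (kap j) n)%:C)
     + csum (negfreq (kap j)) (fun n =>
         cm j n * ((- (4 * pi * freq (kap j) n)) `^ (1 - k))%:C *
         cint (@posreal R) (fun t =>
           laplace (twist phi (2 - k))
             (- (2 * pi * freq (kap j) n * (2 * t + 1)))%:C
           / ((1 + t) `^ k)%:C))).

Definition F_delta (phi : R -> R[i]) : Prop :=
  [/\ piecewise_smooth phi,
      forall s : R[i], - (2 * pi * n0%:R) <= complex.Re s -> laplace_abscvg phi s,
      forall s : R[i], 0 < complex.Re s -> laplace_abscvg (twist phi (3 - k)) s &
      forall j : 'I_m,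
        (\esum_(n in [set: int])
            ((normc (cp j n * (freq (kap j) n)%:C))%:E *
             laplace_norm (twist phi 2) (2 * pi * freq (kap j) n))
         + \esum_(n in negfreq (kap j))
            ((normc (cm j n * (freq (kap j) n)%:C)
              * (4 * pi * `|freq (kap j) n|) `^ (1 - k))%R%:E *
             \int[lebesgue_measure]_(t in @posreal R)
               (laplace_norm (twist phi (3 - k))
                  (- (2 * pi * freq (kap j) n * (2 * t + 1)))
                * (((1 + t) `^ k)^-1)%R%:E))
         < +oo)%E].

Definition L_delta (phi : R -> R[i]) : 'rV[R[i]]_m :=
  (k / 2)%:C *: L_f phi
  - (2 * pi)%:C *: (\row_j
      csum setT (fun n => cp j n * (freq (kap j) n)%:C *
        laplace (twist phi 2) (2 * pi * freq (kap j) n)%:C))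
  - (2 * pi)%:C *: (\row_j
      csum (negfreq (kap j)) (fun n =>
         cm j n * (freq (kap j) n)%:C
         * ((- (4 * pi * freq (kap j) n)) `^ (1 - k))%:C *
         cint (@posreal R) (fun t =>
           laplace (twist phi (3 - k))
             (- (2 * pi * freq (kap j) n * (2 * t + 1)))%:C
           / ((1 + t) `^ k)%:C))).

Definition partial_u (f : R[i] -> 'rV[R[i]]_m) (tau : R[i]) : 'rV[R[i]]_m :=
  \row_j
    (derive1 (fun u : R => complex.Re (f (u +i* complex.Im tau) ord0 j))
       (complex.Re tau)
     +i* derive1 (fun u : R => complex.Im (f (u +i* complex.Im tau) ord0 j))
       (complex.Re tau)).

Definition delta (f : R[i] -> 'rV[R[i]]_m) (tau : R[i]) : 'rV[R[i]]_m :=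
  tau *: partial_u f tau + (k / 2)%:C *: f tau.

(* Integral over (0,oo) of y |-> g(iy) phi(y), componentwise. *)
Definition axis_integrable (g : R[i] -> 'rV[R[i]]_m) (phi : R -> R[i]) : Prop :=
  forall j : 'I_m,
    cintegrable (@posreal R) (fun y => g (0 +i* y) ord0 j * phi y).

Definition axis_integral (g : R[i] -> 'rV[R[i]]_m) (phi : R -> R[i]) :
  'rV[R[i]]_m :=
  \row_j cint (@posreal R) (fun y => g (0 +i* y) ord0 j * phi y).

End Series.

(* Main.v *)
(** A sum over integers is an integral for the counting measure, so the series in
    [f] and the integrals against [phi] obey one and the same Fubini theorem.  On the
    imaginary axis every term of the expansion of [f] is a coefficient times a
    nonnegative weight.  For the holomorphic part the weight is
    [exp (- 2 pi (n + kappa) y)], whose integral against [phi] is a Laplace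
    transform.  For the nonholomorphic part, with [b = - 2 pi (n + kappa) > 0],
    substituting [w (1 + t)] for [t] in the integral of [Gamma (1 - k, w)] gives
    [Gamma (1 - k, 2 b y) e^(b y)
       = (2 b)^(1 - k) int_0^oo y^(1 - k) e^(- b (2 t + 1) y) (1 + t)^(- k) dt],
    and Fubini in [(y, t)] turns its integral against [phi] into the double
    integral of [L_f].

    The statement for [delta_k f] reduces to the one for [f]: differentiating termwise,
    [(2 pi i)^(-1) df/du] is the expansion [g] with coefficients [c(n) (n + kappa)], and
    on the axis [(delta_k f)(iy) phi(y) = (k/2) f(iy) phi(y) - 2 pi g(iy) phi_2(y)], while
    [L_{delta_k f}(phi)] is the same combination of [L_f(phi)] and [L_g(phi_2)]. *)

Require Import Defs.
From HB Require Import structures.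
From mathcomp Require Import all_boot all_order all_algebra.
From mathcomp Require Import all_classical all_reals all_analysis.
From mathcomp Require Import finmap complex measurable_realfun ring lra.

Set Implicit Arguments.
Unset Strict Implicit.
Unset Printing Implicit Defensive.

Import Order.TTheory GRing.Theory Num.Theory.
Import numFieldNormedType.Exports.
Import Normc.

Local Open Scope classical_set_scope.
Local Open Scope ring_scope.
Local Open Scope complex_scope.

(** * Counting measure on a discrete countable type *)

HB.instance Definition _ := isPointed.Build int 0.

HB.instance Definition _ := @isMeasurable.Build default_measure_display
  int discrete_measurable discrete_measurable0
  discrete_measurableC discrete_measurableU.

Section counting_countable.
Context {d : measure_display} {T : measurableType d} {R : realType}.
Hypothesis discreteT : forall A : set T, measurable A.
Hypothesis countableT : countable [set: T].
Local Notation counting := (@counting T R).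

Lemma counting_set1 (x : T) : counting [set x] = 1%E.
Proof. by rewrite /counting asboolT// fset_set1 cardfs1. Qed.

Lemma sigma_finite_counting_countable : sigma_finite [set: T] counting.
Proof.
have [h hinj] := countable_injP _ countableT.
exists (fun n => h @^-1` `I_n.+1) => [|n].
  by apply/seteqP; split=> // x _; exists (h x) => /=.
split; first exact: discreteT.
rewrite /counting/= asboolT ?ltry//.
by apply: finite_preimage => // x y _ _; apply: hinj; exact: mem_set.
Qed.

Lemma ge0_integral_counting (D : set T) (f : T -> \bar R) :
  (forall x, D x -> (0 <= f x)%E) ->
  (\int[counting]_(x in D) f x = \esum_(x in D) f x)%E.
Proof.
move=> f0; rewrite integral_mkcond esum_mkcond.
pose g x := (if x \in D then f x else 0)%E.
have g0 x : (0 <= g x)%E by rewrite /g; case: ifPn => // /set_mem; exact: f0.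
rewrite -[LHS]/(\int[counting]_x g x)%E -[RHS]/(\esum_(x in setT) g x)%E.
have [h hinj] := countable_injP _ countableT.
pose F n := h @^-1` [set n].
have trivF : trivIset setT F by exact: trivIset_preimage1.
have bigF : \bigcup_n F n = setT by apply/seteqP; split=> // x _; exists (h x).
rewrite -bigF ge0_integral_bigcup// esum_bigcupT// nneseries_esumT; last first.
  by move=> n; apply: integral_ge0 => x _; exact: g0.
apply: eq_esum => n _; have [->|/set0P[x Fx]] := eqVneq (F n) set0.
  by rewrite integral_set0 esum_set0.
have -> : F n = [set x].
  apply/seteqP; split=> [y Fy|_ ->//]; apply: hinj; try exact: mem_set.
  by rewrite Fx Fy.
rewrite esum_set1// (eq_integral (cst (g x))) => [|y /set_mem -> //].
by rewrite integral_cst//= counting_set1 mule1.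
Qed.

Lemma measurable_fun_discrete_setX {d2 d3 : measure_display}
    {X : measurableType d2} {Y : measurableType d3} (D : set T) (E : set X)
    (F : T -> X -> Y) : measurable E ->
  (forall n, D n -> measurable_fun E (F n)) ->
  measurable_fun (D `*` E) (fun z => F z.1 z.2).
Proof.
move=> mE mF _ A mA.
rewrite (_ : _ `&` _ = \bigcup_n
    (if n \in D then [set n] `*` (E `&` F n @^-1` A) else set0)); last first.
  apply/seteqP; split=> [[n x] [[/= Dn Ex] AF]|[n x] [i _]].
    by exists n => //; rewrite mem_set.
  by case: ifPn => // /set_mem Di [/= -> [Ex AF]].
apply: countable_bigcupT_measurable => // n; case: ifPn => [/set_mem Dn|_].
  by apply: measurableX => //; exact: mF.
exact: measurable0.
Qed.

End counting_countable.

Lemma countable_int : countable [set: int].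
Proof. exact: countableP. Qed.

Lemma measurable_int_set (D : set int) : measurable D.
Proof. by []. Qed.

HB.instance Definition _ (R : realType) :=
  @Measure_isSigmaFinite.Build _ _ _ (@counting int R)
    (sigma_finite_counting_countable measurable_int_set countable_int).

(** * Fubini's theorem on a product of measurable sets *)

Section Rintegral_fine.
Context {d : measure_display} {T : measurableType d} {R : realType}.
Variables (mu : {measure set T -> \bar R}) (D : set T) (mD : measurable D).
Variables (f : T -> \bar R) (intf : mu.-integrable D f).

Lemma integrable_fine : mu.-integrable D (EFin \o (fine \o f)).
Proof.
have mf := measurable_int mu intf.
apply: le_integrable intf => // [|x _].
  by apply/measurable_EFinP; exact: measurableT_comp (fine_measurable measurableT) mf.
by rewrite /=; case: (f x) => [r| |]; rewrite /= ?normr0 ?leey.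
Qed.

Lemma Rintegral_fine : \int[mu]_(x in D) fine (f x) = fine (\int[mu]_(x in D) f x).
Proof.
rewrite /Rintegral; congr fine; apply: ae_eq_integral => //.
- exact: measurable_int integrable_fine.
- exact: measurable_int intf.
by apply: filterS (integrable_ae mD intf) => x fin_fx /fin_fx/fineK.
Qed.

End Rintegral_fine.

Section restrict_setX.
Context {d1 d2 : measure_display} {T1 : measurableType d1} {T2 : measurableType d2}.
Context {R : realType}.
Variables (m1 : {measure set T1 -> \bar R}) (m2 : {measure set T2 -> \bar R}).
Variables (E1 : set T1) (E2 : set T2) (f : T1 * T2 -> \bar R).

Lemma fubini_F_restrict : fubini_F m2 (f \_ (E1 `*` E2)) =
  (fun x => \int[m2]_(y in E2) f (x, y))%E \_ E1.
Proof.
apply/funext => x; rewrite /fubini_F patchE; case: ifPn => xE1.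
  rewrite [RHS]integral_mkcond; apply: eq_integral => y _.
  by rewrite !patchE in_setX xE1.
by apply: integral0_eq => y _; rewrite patchE in_setX (negbTE xE1).
Qed.

Lemma fubini_G_restrict : fubini_G m1 (f \_ (E1 `*` E2)) =
  (fun y => \int[m1]_(x in E1) f (x, y))%E \_ E2.
Proof.
apply/funext => y; rewrite /fubini_G patchE; case: ifPn => yE2.
  rewrite [RHS]integral_mkcond; apply: eq_integral => x _.
  by rewrite !patchE in_setX yE2 andbT.
by apply: integral0_eq => x _; rewrite patchE in_setX (negbTE yE2) andbF.
Qed.

End restrict_setX.

Section fubini_setX.
Context {d1 d2 : measure_display} {T1 : measurableType d1} {T2 : measurableType d2}.
Context {R : realType}.
Variables (m1 : {sigma_finite_measure set T1 -> \bar R}).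
Variables (m2 : {sigma_finite_measure set T2 -> \bar R}).
Variables (E1 : set T1) (E2 : set T2) (mE1 : measurable E1) (mE2 : measurable E2).

Let mE12 : measurable (E1 `*` E2). Proof. exact: measurableX. Qed.

Section tonelli.
Variable f : T1 * T2 -> \bar R.
Hypothesis mf : measurable_fun (E1 `*` E2) f.
Hypothesis f0 : forall z, (E1 `*` E2) z -> (0 <= f z)%E.

Let mfT : measurable_fun setT (f \_ (E1 `*` E2)).
Proof. exact/(measurable_restrictT _ _).1. Qed.

Let f0T := erestrict_ge0 f0.

Lemma measurable_fubini_tonelli_setX :
  measurable_fun E1 (fun x => \int[m2]_(y in E2) f (x, y))%E.
Proof.
apply/(measurable_restrictT _ mE1); rewrite -fubini_F_restrict.
exact: measurable_fun_fubini_tonelli_F mfT f0T.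
Qed.

Lemma fubini_tonelli1_setX :
  (\int[m1 \x m2]_(z in E1 `*` E2) f z =
   \int[m1]_(x in E1) \int[m2]_(y in E2) f (x, y))%E.
Proof.
rewrite integral_mkcond [RHS]integral_mkcond -fubini_F_restrict.
exact: fubini_tonelli1.
Qed.

Lemma fubini_tonelli_setX :
  (\int[m1]_(x in E1) \int[m2]_(y in E2) f (x, y) =
   \int[m2]_(y in E2) \int[m1]_(x in E1) f (x, y))%E.
Proof.
rewrite -fubini_tonelli1_setX integral_mkcond [RHS]integral_mkcond.
by rewrite -fubini_G_restrict fubini_tonelli2.
Qed.

End tonelli.

Section fubini.
Variable f : T1 * T2 -> \bar R.
Hypothesis intf : (m1 \x m2)%E.-integrable (E1 `*` E2) f.

Let intfT : (m1 \x m2)%E.-integrable setT (f \_ (E1 `*` E2)).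
Proof. exact: (integrable_mkcond f mE12).1. Qed.

Lemma integrable_fubini_F_setX :
  m1.-integrable E1 (fun x => \int[m2]_(y in E2) f (x, y))%E.
Proof.
apply/integrable_mkcond => //; rewrite -fubini_F_restrict.
exact: integrable_fubini_F intfT.
Qed.

Lemma Fubini_setX :
  (\int[m1]_(x in E1) \int[m2]_(y in E2) f (x, y) =
   \int[m2]_(y in E2) \int[m1]_(x in E1) f (x, y))%E.
Proof.
rewrite integral_mkcond [RHS]integral_mkcond.
by rewrite -fubini_F_restrict -fubini_G_restrict; exact: Fubini intfT.
Qed.

End fubini.

End fubini_setX.

Lemma integrable_swap {d1 d2 : measure_display} {T1 : measurableType d1}
    {T2 : measurableType d2} {R : realType}
    (m1 : {sigma_finite_measure set T1 -> \bar R})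
    (m2 : {sigma_finite_measure set T2 -> \bar R})
    (E1 : set T1) (E2 : set T2) (f : T1 * T2 -> \bar R) :
  measurable E1 -> measurable E2 ->
  (m1 \x m2)%E.-integrable (E1 `*` E2) f ->
  (m2 \x m1)%E.-integrable (E2 `*` E1) (fun z => f (z.2, z.1)).
Proof.
move=> mE1 mE2 intf; have mf := measurable_int _ intf.
have mfs : measurable_fun (E2 `*` E1) (fun z => f (z.2, z.1)).
  apply: (measurable_comp (F := E1 `*` E2) (f := f)) mf _; first exact: measurableX.
    by move=> _ [[y x] [/= ? ?] <-].
  by apply: measurable_funTS; exact: measurable_swap.
have mabsf : measurable_fun (E1 `*` E2) (abse \o f) by exact: measurableT_comp.
apply/integrableP; split => //.
rewrite fubini_tonelli1_setX//; last exact: measurableT_comp.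
have /integrableP[_] := intf; rewrite fubini_tonelli1_setX//.
by rewrite (fubini_tonelli_setX _ _ mE1 mE2 mabsf) => [|z _]; [exact|exact: abse_ge0].
Qed.

Section Fubini_Rintegral.
Context {d1 d2 : measure_display} {T1 : measurableType d1} {T2 : measurableType d2}.
Context {R : realType}.
Variables (m1 : {sigma_finite_measure set T1 -> \bar R}).
Variables (m2 : {sigma_finite_measure set T2 -> \bar R}).
Variables (E1 : set T1) (E2 : set T2) (mE1 : measurable E1) (mE2 : measurable E2).
Variable f : T1 * T2 -> R.
Hypothesis intf : (m1 \x m2)%E.-integrable (E1 `*` E2) (EFin \o f).

Lemma integrable_Rintegral1 :
  m1.-integrable E1 (EFin \o (fun x => \int[m2]_(y in E2) f (x, y))).
Proof. exact: integrable_fine (integrable_fubini_F_setX mE1 mE2 intf). Qed.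

Lemma integrable_Rintegral2 :
  m2.-integrable E2 (EFin \o (fun y => \int[m1]_(x in E1) f (x, y))).
Proof.
exact: integrable_fine (integrable_fubini_F_setX mE2 mE1 (integrable_swap mE1 mE2 intf)).
Qed.

Lemma Fubini_Rintegral :
  \int[m1]_(x in E1) \int[m2]_(y in E2) f (x, y) =
  \int[m2]_(y in E2) \int[m1]_(x in E1) f (x, y).
Proof.
rewrite !Rintegral_fine//; last exact: integrable_fubini_F_setX intf.
  by congr fine; exact: Fubini_setX intf.
exact: integrable_fubini_F_setX (integrable_swap mE1 mE2 intf).
Qed.

End Fubini_Rintegral.

(** * Complex-valued integrals *)

Section complex_parts.
Context {R : realType}.
Implicit Types (z w : R[i]) (r : R).

Lemma ReMc z w : complex.Re (z * w) =
  complex.Re z * complex.Re w - complex.Im z * complex.Im w.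
Proof. by case: z => a b; case: w. Qed.

Lemma ImMc z w : complex.Im (z * w) =
  complex.Re z * complex.Im w + complex.Im z * complex.Re w.
Proof. by case: z => a b; case: w. Qed.

Lemma ReDc z w : complex.Re (z + w) = complex.Re z + complex.Re w.
Proof. by case: z => a b; case: w. Qed.

Lemma ImDc z w : complex.Im (z + w) = complex.Im z + complex.Im w.
Proof. by case: z => a b; case: w. Qed.

Lemma eq_ReIm z w : complex.Re z = complex.Re w ->
  complex.Im z = complex.Im w -> z = w.
Proof. by case: z => a b; case: w => c d /= -> ->. Qed.

Lemma complex_eta z : complex.Re z +i* complex.Im z = z.
Proof. by case: z. Qed.

Lemma normcE_sqrt z :
  normc z = Num.sqrt (complex.Re z ^+ 2 + complex.Im z ^+ 2).
Proof. by case: z. Qed.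

Lemma normc_ge0 z : 0 <= normc z.
Proof. by rewrite normcE_sqrt sqrtr_ge0. Qed.

Lemma normc_gt0 z : (0 < normc z) = (z != 0).
Proof.
rewrite lt_neqAle normc_ge0 andbT eq_sym; congr (~~ _).
by apply/eqP/eqP => [/eq0_normc|->]; rewrite ?normc0.
Qed.

Lemma normcR r : normc r%:C = `|r|.
Proof. by rewrite normcE_sqrt /= expr0n addr0 sqrtr_sqr. Qed.

Lemma ler_Re_normc z : `|complex.Re z| <= normc z.
Proof. by have := normc_ge_Re z; rewrite lecR. Qed.

Lemma ler_Im_normc z : `|complex.Im z| <= normc z.
Proof. by rewrite normcE_sqrt -sqrtr_sqr ler_wsqrtr// lerDr sqr_ge0. Qed.

Lemma ler_normc_ReIm z : normc z <= `|complex.Re z| + `|complex.Im z|.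
Proof.
rewrite normcE_sqrt -[leRHS]ger0_norm ?addr_ge0// -sqrtr_sqr ler_wsqrtr//.
rewrite sqrrD !real_normK ?num_real// addrAC lerDl.
by rewrite mulrn_wge0// mulr_ge0.
Qed.

End complex_parts.

Lemma pmule_lty {R : realFieldType} (r : R) (x : \bar R) : 0 < r ->
  (r%:E * x < +oo)%E = (x < +oo)%E.
Proof.
move=> r0; case: x => [x| |]; rewrite ?ltry//.
  by rewrite gt0_muley.
by rewrite gt0_muleNy ?ltNyr.
Qed.

Section Cintegral.
Context {d : measure_display} {T : measurableType d} {R : realType}.
Implicit Types (D : set T) (f g : T -> R[i]) (c : R[i]).

Definition cmeasurable D g :=
  measurable_fun D (fun x => complex.Re (g x)) /\
  measurable_fun D (fun x => complex.Im (g x)).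

Lemma cmeasurable_cst D c : cmeasurable D (cst c).
Proof. by split; exact: measurable_cst. Qed.

Lemma cmeasurable_real D (w : T -> R) : measurable_fun D w ->
  cmeasurable D (fun x => (w x)%:C).
Proof. by move=> mw; split => //; exact: measurable_cst. Qed.

Lemma cmeasurableM D f g : cmeasurable D f -> cmeasurable D g ->
  cmeasurable D (fun x => f x * g x).
Proof.
move=> [mfr mfi] [mgr mgi]; split.
  by under eq_fun do rewrite ReMc; apply: measurable_funB; exact: measurable_funM.
by under eq_fun do rewrite ImMc; apply: measurable_funD; exact: measurable_funM.
Qed.

Lemma measurable_normc D g : cmeasurable D g ->
  measurable_fun D (fun x => normc (g x)).
Proof.
move=> [mr mi]; under eq_fun do rewrite normcE_sqrt.
apply: (measurableT_comp (f := @Num.sqrt R)).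
  by apply: continuous_measurable_fun; exact: sqrt_continuous.
by apply: measurable_funD; exact: measurable_funX.
Qed.

Variable mu : {measure set T -> \bar R}.

Definition Cintegral D g : R[i] :=
  (\int[mu]_(x in D) complex.Re (g x)) +i* (\int[mu]_(x in D) complex.Im (g x)).

Definition Cintegrable D g :=
  mu.-integrable D (EFin \o (fun x => complex.Re (g x))) /\
  mu.-integrable D (EFin \o (fun x => complex.Im (g x))).

Lemma CintegrableP D g : measurable D -> Cintegrable D g <->
  cmeasurable D g /\ (\int[mu]_(x in D) (normc (g x))%:E < +oo)%E.
Proof.
move=> mD; split=> [[ir ii]|[[mr mi] g_lty]].
  have mg : cmeasurable D g.
    by split; apply/measurable_EFinP; [exact: measurable_int ir|exact: measurable_int ii].
  split => //.
  have /integrableP[_] := integrableD mD (integrable_abse ir) (integrable_abse ii).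
  apply: le_lt_trans; apply: ge0_le_integral => //.
  - by move=> x _; rewrite lee_fin normc_ge0.
  - by apply/measurable_EFinP; exact: measurable_normc.
  - apply: measurableT_comp => //; apply: emeasurable_funD;
      by apply: measurableT_comp => //; apply/measurable_EFinP; case: mg.
  - move=> x _; rewrite /= lee_fin (le_trans (ler_normc_ReIm _))//.
    by rewrite [leRHS]ger0_norm ?addr_ge0.
have ig : mu.-integrable D (EFin \o (fun x => normc (g x))).
  apply/integrableP; split; first by apply/measurable_EFinP; exact: measurable_normc.
  by under eq_integral do rewrite /= ger0_norm ?normc_ge0//.
split; apply: le_integrable ig => //; try exact/measurable_EFinP.
- by move=> x _; rewrite /= lee_fin [leRHS]ger0_norm ?normc_ge0// ler_Re_normc.
- by move=> x _; rewrite /= lee_fin [leRHS]ger0_norm ?normc_ge0// ler_Im_normc.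
Qed.

Lemma eq_Cintegral D f g : (forall x, D x -> f x = g x) ->
  Cintegral D f = Cintegral D g.
Proof.
by move=> fg; congr (_ +i* _); apply: eq_Rintegral => x /set_mem Dx; rewrite fg.
Qed.

Lemma eq_Cintegrable D f g : measurable D -> (forall x, D x -> f x = g x) ->
  Cintegrable D f -> Cintegrable D g.
Proof.
by move=> mD fg [fr fi]; split; [apply: eq_integrable fr|apply: eq_integrable fi] => //
  x /set_mem Dx; rewrite /= fg.
Qed.

Lemma CintegrableD D f g : measurable D -> Cintegrable D f -> Cintegrable D g ->
  Cintegrable D (fun x => f x + g x).
Proof.
move=> mD [fr fi] [gr gi]; split.
  by under eq_fun do rewrite /= ReDc; exact: integrableD fr gr.
by under eq_fun do rewrite /= ImDc; exact: integrableD fi gi.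
Qed.

Lemma CintegralD D f g : measurable D -> Cintegrable D f -> Cintegrable D g ->
  Cintegral D (fun x => f x + g x) = Cintegral D f + Cintegral D g.
Proof.
move=> mD [fr fi] [gr gi]; apply: eq_ReIm; rewrite ?ReDc ?ImDc /= -RintegralD//;
  by apply: eq_Rintegral => x _; rewrite ?ReDc ?ImDc.
Qed.

Let integrable_scale D (r : R) (h : T -> R) : measurable D ->
  mu.-integrable D (EFin \o h) -> mu.-integrable D (EFin \o (fun x => r * h x)).
Proof. by move=> mD; exact: integrableZl. Qed.

Lemma CintegrableZl D c g : measurable D -> Cintegrable D g ->
  Cintegrable D (fun x => c * g x).
Proof.
move=> mD [gr gi]; split.
  under eq_fun do rewrite /= ReMc.
  exact: integrableB (integrable_scale _ mD gr) (integrable_scale _ mD gi).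
under eq_fun do rewrite /= ImMc.
exact: integrableD (integrable_scale _ mD gi) (integrable_scale _ mD gr).
Qed.

Lemma CintegralZl D c g : measurable D -> Cintegrable D g ->
  Cintegral D (fun x => c * g x) = c * Cintegral D g.
Proof.
move=> mD [gr gi]; apply: eq_ReIm; rewrite ?ReMc ?ImMc /=.
  under eq_Rintegral do rewrite ReMc.
  by rewrite RintegralB ?RintegralZl//; exact: integrable_scale.
under eq_Rintegral do rewrite ImMc.
by rewrite RintegralD ?RintegralZl//; exact: integrable_scale.
Qed.

Lemma Cintegrable0 D : measurable D -> Cintegrable D (fun=> 0).
Proof. by move=> mD; split; exact: integrable0. Qed.

Lemma Cintegral0 D : Cintegral D (fun=> 0) = 0.
Proof. by rewrite /Cintegral /Rintegral /= integral0. Qed.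

Lemma CintegrableZl_neq0 D c g : measurable D -> (c != 0 -> Cintegrable D g) ->
  Cintegrable D (fun x => c * g x).
Proof.
move=> mD intg; have [->|/intg] := eqVneq c 0; last exact: CintegrableZl.
by apply: eq_Cintegrable (Cintegrable0 mD) => // x _; rewrite mul0r.
Qed.

Lemma CintegralZl_neq0 D c g : measurable D -> (c != 0 -> Cintegrable D g) ->
  Cintegral D (fun x => c * g x) = c * Cintegral D g.
Proof.
move=> mD intg; have [->|/intg] := eqVneq c 0; last exact: CintegralZl.
by rewrite mul0r -[RHS](Cintegral0 D); apply: eq_Cintegral => x _; rewrite mul0r.
Qed.

Lemma Cintegrable_real D (w : T -> R) : measurable D ->
  mu.-integrable D (EFin \o w) -> Cintegrable D (fun x => (w x)%:C).
Proof. by move=> mD intw; split => //; exact: integrable0. Qed.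

Lemma Cintegral_real D (w : T -> R) :
  Cintegral D (fun x => (w x)%:C) = (\int[mu]_(x in D) w x)%:C.
Proof. by rewrite /Cintegral [X in _ +i* X]/Rintegral integral0. Qed.

End Cintegral.

Section Fubini_Cintegral.
Context {d1 d2 : measure_display} {T1 : measurableType d1} {T2 : measurableType d2}.
Context {R : realType}.
Variables (m1 : {sigma_finite_measure set T1 -> \bar R}).
Variables (m2 : {sigma_finite_measure set T2 -> \bar R}).
Variables (E1 : set T1) (E2 : set T2) (mE1 : measurable E1) (mE2 : measurable E2).
Variable g : T1 * T2 -> R[i].

Lemma Cintegrable12ltyP : cmeasurable (E1 `*` E2) g ->
  Cintegrable (m1 \x m2)%E (E1 `*` E2) g <->
  (\int[m1]_(x in E1) \int[m2]_(y in E2) (normc (g (x, y)))%:E < +oo)%E.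
Proof.
move=> mg.
have <- : (\int[m1 \x m2]_(z in E1 `*` E2) (normc (g z))%:E =
    \int[m1]_(x in E1) \int[m2]_(y in E2) (normc (g (x, y)))%:E)%E.
  rewrite fubini_tonelli1_setX// => [|z _]; last by rewrite lee_fin normc_ge0.
  by apply/measurable_EFinP; exact: measurable_normc.
by rewrite CintegrableP; [split=> [[]|]|exact: measurableX].
Qed.

Hypothesis intg : Cintegrable (m1 \x m2)%E (E1 `*` E2) g.

Lemma Cintegrable_fubini_F :
  Cintegrable m1 E1 (fun x => Cintegral m2 E2 (fun y => g (x, y))).
Proof.
by split; [exact: integrable_Rintegral1 intg.1|exact: integrable_Rintegral1 intg.2].
Qed.

Lemma Cintegrable_fubini_G :
  Cintegrable m2 E2 (fun y => Cintegral m1 E1 (fun x => g (x, y))).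
Proof.
by split; [exact: integrable_Rintegral2 intg.1|exact: integrable_Rintegral2 intg.2].
Qed.

Lemma Fubini_Cintegral :
  Cintegral m1 E1 (fun x => Cintegral m2 E2 (fun y => g (x, y))) =
  Cintegral m2 E2 (fun y => Cintegral m1 E1 (fun x => g (x, y))).
Proof.
by congr (_ +i* _); [exact: Fubini_Rintegral intg.1|exact: Fubini_Rintegral intg.2].
Qed.

End Fubini_Cintegral.

(** * Sums over sets of integers *)

Lemma esum_lty {R : realType} {T : choiceType} (D : set T) (a : T -> \bar R) x :
  (forall i, D i -> (0 <= a i)%E) -> (\esum_(i in D) a i < +oo)%E -> D x ->
  (a x < +oo)%E.
Proof.
move=> a0 a_lty Dx; apply: le_lt_trans a_lty.
by apply: esum_ge; exists [set x]; [split => // i ->|rewrite fsbig_set1].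
Qed.

Section int_sums.
Context {R : realType}.
Implicit Types (D : set int) (F G : int -> R[i]) (c : R[i]).
Local Notation count := (@counting int R).

Lemma ge0_integral_int D (a : int -> \bar R) : (forall n, D n -> (0 <= a n)%E) ->
  (\int[count]_(n in D) a n = \esum_(n in D) a n)%E.
Proof. exact: ge0_integral_counting measurable_int_set countable_int _ _. Qed.

Lemma integrable_intP D (a : int -> R) :
  count.-integrable D (EFin \o a) <-> (\esum_(n in D) (`|a n|)%:E < +oo)%E.
Proof.
rewrite -ge0_integral_int//; split=> [/integrableP[]//|a_lty].
exact/integrableP.
Qed.

Lemma rsumE D (a : int -> R) : (\esum_(n in D) (`|a n|)%:E < +oo)%E ->
  rsum D a = \int[count]_(n in D) a n.
Proof.
move=> /integrable_intP inta; rewrite /rsum /Rintegral integralE.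
rewrite fineB ?integrable_pos_fin_num ?integrable_neg_fin_num//.
rewrite !ge0_integral_int//; congr (fine _ - fine _); apply: eq_esum => n _.
  by rewrite funeposE EFin_max.
by rewrite funenegE EFin_max.
Qed.

Lemma csummableP D F : csummable D F <-> Cintegrable count D F.
Proof.
rewrite CintegrableP// ge0_integral_int => [|n _]; last by rewrite lee_fin normc_ge0.
by split=> [sF|[]//]; split.
Qed.

Lemma csumE D F : csummable D F -> csum D F = Cintegral count D F.
Proof.
move=> /csummableP[/integrable_intP sr /integrable_intP si].
by rewrite /csum !rsumE.
Qed.

Lemma eq_csum D F G : (forall n, D n -> F n = G n) -> csum D F = csum D G.
Proof.
by move=> FG; rewrite /csum /rsum; congr (_ +i* _); congr (fine _ - fine _);
  apply: eq_esum => n Dn; rewrite FG.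
Qed.

Lemma le_csummable D F G : (forall n, D n -> normc (F n) <= normc (G n)) ->
  csummable D G -> csummable D F.
Proof.
by move=> FG; apply: le_lt_trans; apply: le_esum => n Dn; rewrite lee_fin FG.
Qed.

Lemma csummableZ D c F : csummable D F -> csummable D (fun n => c * F n).
Proof. by move=> /csummableP sF; apply/csummableP; exact: CintegrableZl. Qed.

Lemma csumZ D c F : csummable D F -> csum D (fun n => c * F n) = c * csum D F.
Proof.
move=> sF; rewrite !csumE//; last exact: csummableZ.
by rewrite CintegralZl//; exact/csummableP.
Qed.

Section termwise_integral.
Context {d : measure_display} {X : measurableType d}.
Variables (mu : {sigma_finite_measure set X -> \bar R}) (E : set X) (mE : measurable E).
Variables (D : set int) (F : int -> X -> R[i]).
Hypothesis mF : forall n, D n -> cmeasurable E (F n).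
Hypothesis F_lty : (\esum_(n in D) \int[mu]_(x in E) (normc (F n x))%:E < +oo)%E.
Hypothesis sF : forall x, E x -> csummable D (F ^~ x).

Let intF : Cintegrable (count \x mu)%E (D `*` E) (fun z => F z.1 z.2).
Proof.
have mFz : cmeasurable (D `*` E) (fun z => F z.1 z.2).
  have mX := measurable_fun_discrete_setX measurable_int_set countable_int.
  split; [apply: (mX _ _ _ _ D E (fun n x => complex.Re (F n x)) mE)|
    apply: (mX _ _ _ _ D E (fun n x => complex.Im (F n x)) mE)] => n Dn.
    exact: (mF Dn).1.
  exact: (mF Dn).2.
apply/(Cintegrable12ltyP _ _ (measurable_int_set D) mE mFz).
rewrite ge0_integral_int// => n _; apply: integral_ge0 => x _.
by rewrite lee_fin normc_ge0.
Qed.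

Lemma Cintegrable_csum : Cintegrable mu E (fun x => csum D (F ^~ x)).
Proof.
apply: eq_Cintegrable (Cintegrable_fubini_G _ _ intF) => // x Ex.
by rewrite csumE//; exact: sF.
Qed.

Lemma Cintegral_csum :
  Cintegral mu E (fun x => csum D (F ^~ x)) = csum D (fun n => Cintegral mu E (F n)).
Proof.
rewrite csumE; last by apply/csummableP; exact: Cintegrable_fubini_F intF.
rewrite (Fubini_Cintegral _ _ intF)//; apply: eq_Cintegral => x Ex.
by rewrite csumE//; exact: sF.
Qed.

End termwise_integral.

Section weighted_sum.
Context {d : measure_display} {X : measurableType d}.
Variables (mu : {sigma_finite_measure set X -> \bar R}) (E : set X) (mE : measurable E).
Variables (D : set int) (c : int -> R[i]) (w : int -> X -> R) (phi : X -> R[i]).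
Hypothesis mphi : cmeasurable E phi.
Hypothesis mw : forall n, D n -> measurable_fun E (w n).
Hypothesis w0 : forall n x, 0 <= w n x.
Hypothesis cwphi_lty : (\esum_(n in D) ((normc (c n))%:E *
  \int[mu]_(x in E) (w n x * normc (phi x))%:E) < +oo)%E.
Hypothesis scw : forall x, E x -> csummable D (fun n => c n * (w n x)%:C).

Let F n x := c n * ((w n x)%:C * phi x).

Let mwphi n : D n -> cmeasurable E (fun x => (w n x)%:C * phi x).
Proof. by move=> Dn; apply: cmeasurableM => //; exact: cmeasurable_real (mw Dn). Qed.

Let normc_wphi n x : normc ((w n x)%:C * phi x) = w n x * normc (phi x).
Proof. by rewrite normcM normcR ger0_norm. Qed.

Let mF n : D n -> cmeasurable E (F n).
Proof. by move=> Dn; apply: cmeasurableM (mwphi Dn); exact: cmeasurable_cst. Qed.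

Let F_lty : (\esum_(n in D) \int[mu]_(x in E) (normc (F n x))%:E < +oo)%E.
Proof.
apply: le_lt_trans cwphi_lty; apply: le_esum => n Dn.
under eq_integral do rewrite normcM normc_wphi EFinM.
rewrite ge0_integralZl//.
- apply/measurable_EFinP; apply: measurable_funM; first exact: mw.
  exact: measurable_normc.
- by move=> x _; rewrite lee_fin mulr_ge0 ?normc_ge0.
- by rewrite lee_fin normc_ge0.
Qed.

Let FE x : F ^~ x = fun n => phi x * (c n * (w n x)%:C).
Proof. by apply/funext => n; rewrite /F mulrA mulrC. Qed.

Let sF x : E x -> csummable D (F ^~ x).
Proof. by move=> Ex; rewrite FE; apply: csummableZ; exact: scw. Qed.

Let csumF x : E x -> csum D (F ^~ x) = csum D (fun n => c n * (w n x)%:C) * phi x.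
Proof. by move=> Ex; rewrite FE csumZ 1?mulrC//; exact: scw. Qed.

Lemma Cintegrable_weighted_csum :
  Cintegrable mu E (fun x => csum D (fun n => c n * (w n x)%:C) * phi x).
Proof. exact: eq_Cintegrable mE csumF (Cintegrable_csum mE mF F_lty sF). Qed.

Lemma Cintegral_weighted_csum :
  Cintegral mu E (fun x => csum D (fun n => c n * (w n x)%:C) * phi x) =
  csum D (fun n => c n * Cintegral mu E (fun x => (w n x)%:C * phi x)).
Proof.
rewrite -(eq_Cintegral mu csumF) (Cintegral_csum mE mF F_lty sF).
apply: eq_csum => n Dn; apply: CintegralZl_neq0 => // cn0.
apply/CintegrableP => //; split; first exact: mwphi.
under eq_integral do rewrite normc_wphi.
rewrite -(@pmule_lty _ (normc (c n))) ?normc_gt0//.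
apply: (esum_lty _ cwphi_lty Dn) => i _; rewrite mule_ge0 ?lee_fin ?normc_ge0//.
by apply: integral_ge0 => x _; rewrite lee_fin mulr_ge0 ?normc_ge0.
Qed.

End weighted_sum.

Lemma is_derive_rsum D (f df : int -> R -> R) (M : int -> R) (x : R) :
  (forall n u, D n -> is_derive u (1 : R) (f n) (df n u)) ->
  (forall n u, D n -> `|df n u| <= M n) ->
  (\esum_(n in D) (`|M n|)%:E < +oo)%E ->
  (forall u, \esum_(n in D) (`|f n u|)%:E < +oo)%E ->
  is_derive x (1 : R) (fun u => rsum D (f ^~ u)) (rsum D (df ^~ x)).
Proof.
move=> fdf dfM sM sf.
have dfE n u : D n -> partial1of2 (fun u n => f n u) u n = df n u.
  by move=> Dn; rewrite partial1of2E; exact: (@derive_val _ _ _ _ _ _ _ (fdf n u Dn)).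
have xI : `]x - 1, x + 1[%classic x by rewrite /= in_itv /=; lra.
have intf u : `]x - 1, x + 1[%classic u -> count.-integrable D (EFin \o f ^~ u).
  by move=> _; apply/integrable_intP; exact: sf.
have intM : count.-integrable D (EFin \o (fun n => `|M n|)).
  by apply/integrable_intP; under eq_esum do rewrite normr_id.
have dom u n : `]x - 1, x + 1[%classic u -> D n ->
    `|partial1of2 (fun u n => f n u) u n| <= `|M n|.
  by move=> _ Dn; rewrite dfE// (le_trans (dfM n u Dn))// ler_norm.
have derf u n : `]x - 1, x + 1[%classic u -> D n -> derivable (f n) u 1.
  by move=> _ Dn; case: (fdf n u Dn).
have sdf : (\esum_(n in D) (`|df n x|)%:E < +oo)%E.
  apply: le_lt_trans sM; apply: le_esum => n Dn.
  by rewrite lee_fin (le_trans (dfM n x Dn))// ler_norm.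
have -> : (fun u => rsum D (f ^~ u)) = (fun u => \int[count]_(n in D) f n u).
  by apply/funext => u; rewrite rsumE.
have -> : rsum D (df ^~ x) = \int[count]_(n in D) partial1of2 (fun u n => f n u) x n.
  by rewrite rsumE//; apply: eq_Rintegral => n /set_mem Dn; rewrite dfE.
apply: DeriveDef.
  exact: (derivable_under_integral (measurable_int_set D) xI intf derf _ intM dom).
rewrite -derive1E.
exact: (differentiation_under_integral (measurable_int_set D) xI intf derf _ intM dom).
Qed.

End int_sums.

(** * The incomplete gamma function *)

Section positive_reals.
Context {R : realType}.
Local Notation E := (@posreal R).

(* [measurableTypeR R] is the carrier of [lebesgue_measure]. *)
Lemma measurable_posreal : measurable (E : set (measurableTypeR R)).
Proof. exact: measurable_itv. Qed.

Lemma posrealP (x : R) : E x <-> 0 < x.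
Proof. by rewrite /posreal /= in_itv /= andbT. Qed.

End positive_reals.

#[local] Hint Extern 0 (measurable (@posreal ?R)) => exact (@measurable_posreal R) : core.

Section measurable_exp_pow.
Context {d : measure_display} {T : measurableType d} {R : realType}.
Implicit Types (D : set T) (f : T -> R).

Lemma measurable_fun_expR D f : measurable_fun D f ->
  measurable_fun D (fun x => expR (f x)).
Proof. by move=> mf; apply: measurableT_comp mf; exact: measurable_expR. Qed.

Lemma measurable_fun_powR D f (p : R) : measurable_fun D f ->
  measurable_fun D (fun x => f x `^ p).
Proof. by move=> mf; apply: (measurableT_comp (measurable_powR p) mf). Qed.

End measurable_exp_pow.

Lemma is_derive_mull {R : realType} (c x : R) : is_derive x (1 : R) (fun u => c * u) c.
Proof.
have : is_derive x (1 : R) (c *: (id : R -> R)) (c *: 1) by apply: is_deriveZ.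
by rewrite /GRing.scale /= mulr1.
Qed.

Section inc_gamma.
Context {R : realType}.
Local Notation mu := (@lebesgue_measure R).
Local Notation E := (@posreal R).
Implicit Types a b c k p t w y : R.

Lemma ge0_integral_ray_scale (g : R -> R) w : 0 < w ->
  measurable_fun setT g -> (forall x, 0 <= g x) ->
  (forall x, 0 < x -> {for x, continuous g}) ->
  (\int[mu]_(x in `]w, +oo[) (g x)%:E =
   \int[mu]_(x in E) (w * g (w * (1 + x)))%:E)%E.
Proof.
move=> w0 mg g0 cg; pose F x : R := w * (1 + x).
have dF x : is_derive x (1 : R) F w.
  have d1D : is_derive x (1 : R) (cst 1 + id : R -> R) (0 + 1) by apply: is_deriveD.
  by have := is_derive1_comp (is_derive_mull w (1 + x)) d1D; rewrite add0r mulr1.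
have F' : F^`()%classic = cst w.
  by apply/funext => x; rewrite derive1E; exact: derive_val.
have F0 : F 0 = w by rewrite /F addr0 mulr1.
have mgF : measurable_fun setT (g \o F).
  by apply: measurableT_comp mg _; apply: measurable_funM => //; exact: measurable_funD.
rewrite integral_itv_obnd_cbnd; last by apply/measurable_EFinP; exact: measurable_funTS.
rewrite /posreal integral_itv_obnd_cbnd; last first.
  by apply/measurable_EFinP; apply: measurable_funM => //; exact: measurable_funTS.
rewrite -[in LHS]F0 increasing_ge0_integration_by_substitutiony//.
- by apply: eq_integral => x _; rewrite F' /= mulrC.
- by move=> x y _ _ xy; rewrite ltr_pM2l// ltrD2l.
- by move=> x _; rewrite F'; exact: cst_continuous.
- by rewrite F'; exact: is_cvg_cst.
- by rewrite F'; exact: is_cvg_cst.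
- split=> [x _|]; first by apply: ex_derive.
  apply: cvg_at_right_filter; apply: differentiable_continuous.
  by apply/derivable1_diffP; apply: ex_derive.
- apply/cvgryPge => A; near=> x.
  rewrite /F mulrC -ler_pdivrMr//.
  have Ax : A / w <= x by near: x; apply: nbhs_pinfty_ge; rewrite num_real.
  by rewrite (le_trans Ax)// lerDr.
- rewrite F0; apply: continuous_in_subspaceT => x /set_mem.
  by rewrite /= in_itv /= andbT => wx; apply: cg; exact: lt_le_trans wx.
Unshelve. all: by end_near. Qed.

Lemma powR_1D_le_expR c p : 0 < c ->
  exists C, forall t, 0 < t -> (1 + t) `^ p <= C * expR (c * t).
Proof.
move=> c0; set q := `|p| + 1; set e := c / q.
have q0 : 0 < q by rewrite ltr_wpDl.
have e0 : 0 < e by rewrite divr_gt0.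
exists (expR (q * (e - ln e))) => t t0.
have t1 : 0 < 1 + t by rewrite addr_gt0.
have ln_ge0 : 0 <= ln (1 + t) by rewrite ln_ge0// lerDl ltW.
have ln_le : ln (e * (1 + t)) <= e * (1 + t) - 1.
  have := @le_ln1Dx R (e * (1 + t) - 1); rewrite subrKC; apply.
  by rewrite ltrBrDl subrr mulr_gt0.
rewrite lnM ?posrealE// in ln_le.
rewrite /powR gt_eqF// -expRD ler_expR (@le_trans _ _ (q * ln (1 + t)))//.
  by rewrite ler_wpM2r// (le_trans (ler_norm _))// /q lerDl.
have -> : c = q * e by rewrite /e mulrC divfK// gt_eqF.
by rewrite -mulrA -mulrDr ler_wpM2l ?(ltW q0)//; lra.
Qed.

Lemma integrable_expR_powR c p : 0 < c ->
  mu.-integrable E (EFin \o (fun t => expR (- (c * t)) * (1 + t) `^ p)).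
Proof.
move=> c0; pose d := c / 2; have d0 : 0 < d by rewrite divr_gt0.
have [C powC] := powR_1D_le_expR p d0.
have intpdf : mu.-integrable E (EFin \o exponential_pdf d).
  by apply: integrableS (integrable_exponential_pdf d0).
apply: (le_integrable _ _ _ (integrableZl _ (C / d) intpdf)) => //.
  apply/measurable_EFinP; apply: measurable_funM.
    by apply: measurable_fun_expR; apply: measurable_funN; exact: measurable_funM.
  by apply: measurable_fun_powR; exact: measurable_funD.
move=> t /posrealP t0; rewrite /= lee_fin.
rewrite (exponential_pdfE _ (ltW t0)) ger0_norm ?mulr_ge0 ?expR_ge0 ?powR_ge0//.
rewrite (le_trans _ (ler_norm _))//.
have -> : C / d * (d * expR (- d * t)) = C * expR (- d * t).
  by field; rewrite gt_eqF.
rewrite (le_trans (ler_wpM2l (expR_ge0 _) (powC t t0)))//.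
rewrite le_eqVlt mulrCA -expRD; apply/orP; left; apply/eqP.
by congr (C * expR _); rewrite /d; field.
Qed.

Lemma inc_gammaE a w : 0 < w ->
  inc_gamma a w = w `^ a * expR (- w) *
    \int[mu]_(t in E) (expR (- (w * t)) * (1 + t) `^ (a - 1)).
Proof.
move=> w0; rewrite -RintegralZl//; last exact: integrable_expR_powR.
pose g t : R := expR (- t) * t `^ (a - 1).
have mg : measurable_fun setT g.
  apply: measurable_funM; last exact: measurable_fun_powR.
  by apply: measurable_fun_expR; exact: measurable_funN.
have g0 t : 0 <= g t by rewrite mulr_ge0 ?expR_ge0 ?powR_ge0.
have cg t : 0 < t -> {for t, continuous g}.
  move=> t0; apply: continuousM.
    by apply: continuous_comp; [exact: continuousN|exact: continuous_expR].
  by apply: differentiable_continuous; apply/derivable1_diffP;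
    apply: ex_derive; exact: is_derive1_powR.
congr fine; apply: etrans (ge0_integral_ray_scale w0 mg g0 cg) _.
apply: eq_integral => t /set_mem /posrealP t0; rewrite /g.
rewrite powRM ?(ltW w0) ?addr_ge0 ?(ltW t0)// mulrDr mulr1 opprD expRD.
have -> : w `^ a = w * w `^ (a - 1).
  by rewrite -{2}(powRr1 (ltW w0)) -powRD ?subrKC// (gt_eqF w0) implybT.
by congr EFin; ring.
Qed.

Lemma inc_gamma_ge0 a w : 0 <= inc_gamma a w.
Proof. by apply: Rintegral_ge0 => t _; rewrite mulr_ge0 ?expR_ge0 ?powR_ge0. Qed.

(* For [b = - 2 pi (n + kappa)], this is
   [Gamma (1 - k, - 4 pi (n + kappa) y) e^(- 2 pi (n + kappa) y)]. *)
Definition gamma_weight k b y : R := inc_gamma (1 - k) (2 * b * y) * expR (b * y).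

Lemma gamma_weight_ge0 k b y : 0 <= gamma_weight k b y.
Proof. by rewrite mulr_ge0 ?inc_gamma_ge0 ?expR_ge0. Qed.

Definition gamma_kernel k b y t : R :=
  y `^ (1 - k) * expR (- (b * (2 * t + 1) * y)) * (1 + t) `^ (- k).

Lemma gamma_kernel_ge0 k b y t : 0 <= gamma_kernel k b y t.
Proof. by rewrite !mulr_ge0 ?expR_ge0 ?powR_ge0. Qed.

Let gamma_kernelE k b y t : gamma_kernel k b y t =
  y `^ (1 - k) * expR (- (b * y)) * (expR (- (2 * b * y * t)) * (1 + t) `^ (- k)).
Proof.
rewrite /gamma_kernel.
have -> : - (b * (2 * t + 1) * y) = - (b * y) + - (2 * b * y * t) by ring.
by rewrite expRD; ring.
Qed.

Lemma integrable_gamma_kernel k b y : 0 < b -> 0 < y ->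
  mu.-integrable E (EFin \o gamma_kernel k b y).
Proof.
move=> b0 y0; have w0 : 0 < 2 * b * y by rewrite !mulr_gt0.
have intk : mu.-integrable E (fun t => (y `^ (1 - k) * expR (- (b * y)))%:E *
    (expR (- (2 * b * y * t)) * (1 + t) `^ (- k))%:E)%E.
  by apply: integrableZl => //; exact: integrable_expR_powR.
by apply: eq_integrable intk => // t _; rewrite /= gamma_kernelE.
Qed.

Lemma gamma_weightE k b y : 0 < b -> 0 < y ->
  gamma_weight k b y = (2 * b) `^ (1 - k) * \int[mu]_(t in E) gamma_kernel k b y t.
Proof.
move=> b0 y0; have w0 : 0 < 2 * b * y by rewrite !mulr_gt0.
under [in RHS]eq_Rintegral do rewrite gamma_kernelE.
rewrite RintegralZl//; last exact: integrable_expR_powR.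
rewrite /gamma_weight inc_gammaE// powRM ?(ltW y0) ?mulr_ge0 ?(ltW b0)//.
rewrite (_ : 1 - k - 1 = - k); last by ring.
have -> : expR (- (b * y)) = expR (- (2 * b * y)) * expR (b * y).
  by rewrite -expRD; congr expR; ring.
by ring.
Qed.

Lemma gamma_weight_half k b y : 0 < b -> 0 < y -> gamma_weight k b y <=
  2 `^ (1 - k) * expR (- (b * (y / 2))) * gamma_weight k b (y / 2).
Proof.
move=> b0 y0; have y20 : 0 < y / 2 by rewrite divr_gt0.
rewrite !gamma_weightE// mulrCA ler_wpM2l ?powR_ge0// -RintegralZl//; last first.
  exact: integrable_gamma_kernel.
apply: le_Rintegral => //; first exact: integrable_gamma_kernel.
  exact: (integrableZl _ _ (integrable_gamma_kernel k b0 y20)).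
move=> t /posrealP t0; rewrite /gamma_kernel.
have -> : y `^ (1 - k) = 2 `^ (1 - k) * (y / 2) `^ (1 - k).
  by rewrite -powRM ?(ltW y20)//; congr (_ `^ _); field.
rewrite [leRHS]mulrA ler_wpM2r ?powR_ge0// [leRHS]mulrACA.
rewrite ler_wpM2l ?mulr_ge0 ?powR_ge0// -expRD ler_expR.
have : 0 <= b * y * t by rewrite !mulr_ge0// ltW.
lra.
Qed.

End inc_gamma.

(** * Laplace transforms at real points *)

Section laplace_real.
Context {R : realType}.
Local Notation mu := (@lebesgue_measure R).
Local Notation E := (@posreal R).
Implicit Types (phi psi : R -> R[i]) (s t : R).

Lemma cexp_real (r : R) : cexp r%:C = (expR r)%:C.
Proof. by rewrite /cexp /= cos0 sin0 mulr1 mulr0. Qed.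

Lemma cexp_laplace s t : cexp (- (s%:C * t%:C)) = (expR (- (s * t)))%:C.
Proof. by rewrite -cexp_real rmorphN rmorphM. Qed.

Lemma laplaceE phi s :
  laplace phi s%:C = Cintegral mu E (fun t => (expR (- (s * t)))%:C * phi t).
Proof. by apply: eq_Cintegral => t _; rewrite cexp_laplace. Qed.

Lemma cintegrableP (g : R -> R[i]) : cintegrable E g <-> Cintegrable mu E g.
Proof.
by rewrite CintegrableP//; split=> [[mr mi g_lty]|[[mr mi] g_lty]].
Qed.

Lemma laplace_abscvgP phi s : laplace_abscvg phi s%:C <->
  Cintegrable mu E (fun t => (expR (- (s * t)))%:C * phi t).
Proof.
rewrite /laplace_abscvg cintegrableP.
by split; apply: eq_Cintegrable => // t _; rewrite cexp_laplace.
Qed.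

Lemma laplace_abscvg0_cmeasurable phi : laplace_abscvg phi 0 -> cmeasurable E phi.
Proof.
move=> /laplace_abscvgP/CintegrableP-/(_ measurable_posreal)[].
by under eq_fun do rewrite mul0r oppr0 expR0 mul1r.
Qed.

Lemma twist_twist phi (a b : R) t : 0 < t ->
  twist (twist phi a) b t = twist phi (a + b - 1) t.
Proof.
move=> t0; rewrite /twist -mulrA -rmorphM /= -powRD ?(gt_eqF t0) ?implybT//.
by congr (_ * (_ `^ _)%:C); ring.
Qed.

Lemma twist2E phi t : 0 < t -> twist phi 2 t = t%:C * phi t.
Proof.
by move=> t0; rewrite /twist (_ : 2 - 1 = 1) ?powRr1 ?(ltW t0) 1?mulrC//; ring.
Qed.

Lemma cmeasurable_twist phi s : cmeasurable E phi -> cmeasurable E (twist phi s).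
Proof.
move=> mphi; apply: cmeasurableM => //; apply: cmeasurable_real.
exact: measurable_fun_powR.
Qed.

Lemma measurable_laplace_norm phi s : cmeasurable E phi ->
  measurable_fun E (fun t => (expR (- (s * t)) * normc (phi t))%:E).
Proof.
move=> mphi; apply/measurable_EFinP; apply: measurable_funM; last exact: measurable_normc.
by apply: measurable_fun_expR; apply: measurable_funN; exact: measurable_funM.
Qed.

Lemma laplace_norm_ge0 phi s : (0 <= laplace_norm phi s)%E.
Proof.
by apply: integral_ge0 => t _; rewrite lee_fin mulr_ge0 ?expR_ge0 ?normc_ge0.
Qed.

Lemma eq_laplace phi psi s : (forall t, 0 < t -> phi t = psi t) ->
  laplace phi s%:C = laplace psi s%:C.
Proof.
by move=> e; rewrite !laplaceE; apply: eq_Cintegral => t /posrealP t0; rewrite e.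
Qed.

Lemma eq_laplace_norm phi psi s : (forall t, 0 < t -> phi t = psi t) ->
  laplace_norm phi s = laplace_norm psi s.
Proof. by move=> e; apply: eq_integral => t /set_mem /posrealP t0; rewrite e. Qed.

Lemma eq_laplace_abscvg phi psi s : (forall t, 0 < t -> phi t = psi t) ->
  laplace_abscvg phi s%:C -> laplace_abscvg psi s%:C.
Proof.
move=> e /laplace_abscvgP intphi; apply/laplace_abscvgP.
by apply: eq_Cintegrable intphi => // t /posrealP t0; rewrite e.
Qed.

End laplace_real.

Section gamma_weight_integral.
Context {R : realType}.
Local Notation mu := (@lebesgue_measure R).
Local Notation E := (@posreal R).
Variables (k b : R) (phi : R -> R[i]).
Hypotheses (b_gt0 : 0 < b) (mphi : cmeasurable E phi).

(* The [t]-integrands of the second sums of [L_f] and of condition (iii) of [F_f], for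
   [b = - 2 pi (n + kappa)]. *)
Definition gamma_laplace (t : R) : R[i] :=
  laplace (twist phi (2 - k)) (b * (2 * t + 1))%:C / ((1 + t) `^ k)%:C.

Definition gamma_laplace_norm (t : R) : \bar R :=
  (laplace_norm (twist phi (2 - k)) (b * (2 * t + 1)) * (((1 + t) `^ k)^-1)%:E)%E.

Lemma gamma_laplace_norm_ge0 t : (0 <= gamma_laplace_norm t)%E.
Proof. by rewrite mule_ge0 ?laplace_norm_ge0// lee_fin invr_ge0 powR_ge0. Qed.

Let invcR (r : R) : (r%:C)^-1 = (r^-1)%:C :> R[i].
Proof. by rewrite [RHS](fmorphV (real_complex R)). Qed.

Let kernel_twist t y : (gamma_kernel k b y t)%:C * phi y =
  (((1 + t) `^ k)^-1)%:C *
    ((expR (- (b * (2 * t + 1) * y)))%:C * twist phi (2 - k) y).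
Proof.
rewrite /gamma_kernel /twist powRN (_ : 2 - k - 1 = 1 - k); last by ring.
by rewrite !rmorphM; ring.
Qed.

Let measurable_kernel : measurable_fun (E `*` E) (fun z => gamma_kernel k b z.1 z.2).
Proof.
have m1 : measurable_fun (E `*` E) (fst : R * R -> R) by exact: measurable_funTS.
have m2 : measurable_fun (E `*` E) (snd : R * R -> R) by exact: measurable_funTS.
apply: measurable_funM; last first.
  by apply: measurable_fun_powR; exact: measurable_funD.
apply: measurable_funM; first exact: measurable_fun_powR.
apply: measurable_fun_expR; apply: measurable_funN.
apply: measurable_funM => //; apply: measurable_funM => //; apply: measurable_funD => //.
exact: measurable_funM.
Qed.

Let cmeasurable_kernel :
  cmeasurable (E `*` E) (fun z => (gamma_kernel k b z.1 z.2)%:C * phi z.1).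
Proof.
apply: cmeasurableM; first exact: cmeasurable_real measurable_kernel.
have comp_fst (h : R -> R) : measurable_fun E h ->
    measurable_fun (E `*` E) (fun z : R * R => h z.1).
  move=> mh; apply: (measurable_comp (F := E)) mh _ => //; last exact: measurable_funTS.
  by move=> _ [z [? ?] <-].
by split; [exact: (comp_fst _ mphi.1)|exact: (comp_fst _ mphi.2)].
Qed.

Let measurable_normc_kernel : measurable_fun (E `*` E)
  (fun z => (normc ((gamma_kernel k b z.1 z.2)%:C * phi z.1))%:E).
Proof. by apply/measurable_EFinP; exact: measurable_normc. Qed.

Let normc_kernel_ge0 z : (E `*` E) z ->
  (0 <= (normc ((gamma_kernel k b z.1 z.2)%:C * phi z.1))%:E)%E.
Proof. by rewrite lee_fin normc_ge0. Qed.

Let gamma_laplace_normE t : (gamma_laplace_norm t =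
  \int[mu]_(y in E) (normc ((gamma_kernel k b y t)%:C * phi y))%:E)%E.
Proof.
rewrite /gamma_laplace_norm muleC -ge0_integralZl//.
- apply: eq_integral => y _; rewrite kernel_twist !normcM !normcR.
  by rewrite !ger0_norm ?expR_ge0 ?invr_ge0 ?powR_ge0.
- exact: measurable_laplace_norm (cmeasurable_twist _ mphi).
- by move=> y _; rewrite lee_fin mulr_ge0 ?expR_ge0 ?normc_ge0.
- by rewrite lee_fin invr_ge0 powR_ge0.
Qed.

Let integral_normc_kernel :
  (\int[mu]_(y in E) \int[mu]_(t in E) (normc ((gamma_kernel k b y t)%:C * phi y))%:E =
   \int[mu]_(t in E) gamma_laplace_norm t)%E.
Proof.
apply: etrans (fubini_tonelli_setX mu mu measurable_posreal measurable_posreal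
  measurable_normc_kernel normc_kernel_ge0) _.
by apply: eq_integral => t _; rewrite gamma_laplace_normE.
Qed.

Lemma measurable_gamma_weight : measurable_fun E (gamma_weight k b).
Proof.
apply: (eq_measurable_fun (fun y => (2 * b) `^ (1 - k) *
    fine (\int[mu]_(t in E) (gamma_kernel k b y t)%:E)%E)).
  by move=> y /set_mem /posrealP y0; rewrite gamma_weightE.
apply: measurable_funM => //; apply: measurableT_comp => //.
have mK : measurable_fun (E `*` E) (fun z => (gamma_kernel k b z.1 z.2)%:E).
  by apply/measurable_EFinP; exact: measurable_kernel.
apply: (measurable_fubini_tonelli_setX mu measurable_posreal measurable_posreal mK) => z _.
by rewrite lee_fin gamma_kernel_ge0.
Qed.

Lemma integral_gamma_weight_normc :
  (\int[mu]_(y in E) (gamma_weight k b y * normc (phi y))%:E =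
   ((2 * b) `^ (1 - k))%:E * \int[mu]_(t in E) gamma_laplace_norm t)%E.
Proof.
rewrite -integral_normc_kernel -ge0_integralZl//; last first.
- by rewrite lee_fin powR_ge0.
- by move=> y _; apply: integral_ge0 => t _; rewrite lee_fin normc_ge0.
- exact: (measurable_fubini_tonelli_setX mu measurable_posreal measurable_posreal
    measurable_normc_kernel normc_kernel_ge0).
apply: eq_integral => y /set_mem /posrealP y0.
have intk := integrable_gamma_kernel k b_gt0 y0.
under [in RHS]eq_integral do
  rewrite normcM normcR ger0_norm ?gamma_kernel_ge0// mulrC EFinM.
rewrite integralZl// -[X in (_ * (_ * X))%E]fineK; last exact: integrable_fin_num intk.
by rewrite gamma_weightE// -!EFinM -/(Rintegral _ _ _); congr EFin; ring.
Qed.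

Hypothesis laplace_phi : forall s : R, 0 < s -> laplace_abscvg (twist phi (2 - k)) s%:C.
Hypothesis laplace_norm_lty : (\int[mu]_(t in E) gamma_laplace_norm t < +oo)%E.

Lemma Cintegral_gamma_weight :
  Cintegral mu E (fun y => (gamma_weight k b y)%:C * phi y) =
  ((2 * b) `^ (1 - k))%:C * Cintegral mu E gamma_laplace.
Proof.
have intg : Cintegrable (mu \x mu)%E (E `*` E)
    (fun z => (gamma_kernel k b z.1 z.2)%:C * phi z.1).
  apply/(Cintegrable12ltyP mu mu measurable_posreal measurable_posreal cmeasurable_kernel).
  by rewrite integral_normc_kernel.
have inner_t y : E y -> (gamma_weight k b y)%:C * phi y =
    ((2 * b) `^ (1 - k))%:C *
    Cintegral mu E (fun t => (gamma_kernel k b y t)%:C * phi y).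
  move=> /posrealP y0; have intk := integrable_gamma_kernel k b_gt0 y0.
  under [in RHS]eq_fun do rewrite mulrC.
  rewrite CintegralZl//; last exact: Cintegrable_real.
  by rewrite Cintegral_real gamma_weightE// rmorphM mulrAC mulrA.
have inner_y t : E t -> gamma_laplace t =
    Cintegral mu E (fun y => (gamma_kernel k b y t)%:C * phi y).
  move=> /posrealP t0; have s0 : 0 < b * (2 * t + 1).
    by rewrite mulr_gt0// addr_gt0// mulr_gt0.
  rewrite /gamma_laplace laplaceE invcR mulrC -CintegralZl//.
    by apply: eq_Cintegral => y _; rewrite kernel_twist.
  by apply/laplace_abscvgP; exact: laplace_phi.
rewrite (eq_Cintegral mu inner_t) (eq_Cintegral mu inner_y).
have intF : Cintegrable mu E
    (fun y => Cintegral mu E (fun t => (gamma_kernel k b y t)%:C * phi y)).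
  exact: (Cintegrable_fubini_F measurable_posreal measurable_posreal intg).
rewrite (CintegralZl ((2 * b) `^ (1 - k))%:C measurable_posreal intF).
apply: (congr1 (GRing.mul _)).
exact: (Fubini_Cintegral measurable_posreal measurable_posreal intg).
Qed.

End gamma_weight_integral.

(** * Integrals of weighted sums over the positive reals *)

Section csum_weights.
Context {R : realType}.
Local Notation mu := (@lebesgue_measure R).
Local Notation E := (@posreal R).
Variables (D : set int) (c : int -> R[i]) (phi : R -> R[i]).
Hypothesis mphi : cmeasurable E phi.

Lemma Cintegral_csum_expR (la : int -> R) :
  (\esum_(n in D) ((normc (c n))%:E * laplace_norm phi (la n)) < +oo)%E ->
  (forall y, E y -> csummable D (fun n => c n * (expR (- (la n * y)))%:C)) ->
  let f y := csum D (fun n => c n * (expR (- (la n * y)))%:C) * phi y in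
  Cintegrable mu E f /\
  Cintegral mu E f = csum D (fun n => c n * laplace phi (la n)%:C).
Proof.
move=> phi_lty sc f.
have me n : D n -> measurable_fun E (fun y => expR (- (la n * y))).
  by move=> _; apply: measurable_fun_expR; apply: measurable_funN; exact: measurable_funM.
have e0 n y : 0 <= expR (- (la n * y)) by exact: expR_ge0.
split; first exact: (Cintegrable_weighted_csum measurable_posreal mphi me e0 phi_lty sc).
apply: etrans (Cintegral_weighted_csum measurable_posreal mphi me e0 phi_lty sc) _.
by apply: eq_csum => n _; rewrite laplaceE.
Qed.

Lemma Cintegral_csum_gamma_weight (b : int -> R) (k : R) :
  (forall n, D n -> 0 < b n) ->
  (forall s : R, 0 < s -> laplace_abscvg (twist phi (2 - k)) s%:C) ->
  (\esum_(n in D) ((normc (c n) * (2 * b n) `^ (1 - k))%:E *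
     \int[mu]_(t in E) gamma_laplace_norm k (b n) phi t) < +oo)%E ->
  (forall y, E y -> csummable D (fun n => c n * (gamma_weight k (b n) y)%:C)) ->
  let f y := csum D (fun n => c n * (gamma_weight k (b n) y)%:C) * phi y in
  Cintegrable mu E f /\
  Cintegral mu E f = csum D (fun n => c n * ((2 * b n) `^ (1 - k))%:C *
    Cintegral mu E (gamma_laplace k (b n) phi)).
Proof.
move=> b0 lphi phi_lty sc f.
have mw n : D n -> measurable_fun E (gamma_weight k (b n)).
  by move=> /b0; exact: measurable_gamma_weight.
have w0 n y : 0 <= gamma_weight k (b n) y by exact: gamma_weight_ge0.
have w_lty : (\esum_(n in D) ((normc (c n))%:E *
    \int[mu]_(y in E)
      (gamma_weight k (b n) y * normc (phi y))%:E) < +oo)%E.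
  apply: le_lt_trans phi_lty; apply: le_esum => n Dn.
  by rewrite (integral_gamma_weight_normc _ (b0 n Dn) mphi) EFinM muleA.
split; first exact: (Cintegrable_weighted_csum measurable_posreal mphi mw w0 w_lty sc).
apply: etrans (Cintegral_weighted_csum measurable_posreal mphi mw w0 w_lty sc) _.
apply: eq_csum => n Dn; have [->|cn0] := eqVneq (c n) 0; first by rewrite !mul0r.
rewrite -mulrA; apply: (congr1 (GRing.mul _)).
apply: Cintegral_gamma_weight => //; first exact: b0.
have gl0 i : (0 <= \int[mu]_(t in E) gamma_laplace_norm k (b i) phi t)%E.
  by apply: integral_ge0 => t _; exact: gamma_laplace_norm_ge0.
have := esum_lty _ phi_lty Dn; rewrite pmule_lty => [|]; last first.
  by rewrite mulr_gt0 ?normc_gt0// powR_gt0// mulr_gt0// b0.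
by apply=> i _; rewrite mule_ge0// lee_fin mulr_ge0 ?normc_ge0 ?powR_ge0.
Qed.

End csum_weights.

(** * Termwise differentiation along horizontal lines *)

Section horizontal_derivative.
Context {R : realType}.

Definition cis (x : R) : R[i] := cos x +i* sin x.

Lemma cis0 : cis 0 = 1.
Proof. by rewrite /cis cos0 sin0. Qed.

Lemma normc_cis x : normc (cis x) = 1.
Proof. by rewrite /= cos2Dsin2 sqrtr1. Qed.

Definition is_Cderive (x : R) (g : R -> R[i]) (dg : R[i]) :=
  is_derive x (1 : R) (fun u => complex.Re (g u)) (complex.Re dg) /\
  is_derive x (1 : R) (fun u => complex.Im (g u)) (complex.Im dg).

Lemma is_CderiveD x f g df dg : is_Cderive x f df -> is_Cderive x g dg ->
  is_Cderive x (fun u => f u + g u) (df + dg).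
Proof.
move=> [fr fi] [gr gi]; split.
  by rewrite ReDc; under eq_fun do rewrite ReDc; exact: is_deriveD fr gr.
by rewrite ImDc; under eq_fun do rewrite ImDc; exact: is_deriveD fi gi.
Qed.

Lemma is_derive_cosDsin (a b th x : R) :
  is_derive x (1 : R) (fun u => a * cos (th * u) + b * sin (th * u))
    (th * (b * cos (th * x) - a * sin (th * x))).
Proof.
have dth := is_derive_mull th x.
have dcos : is_derive x (1 : R) (a *: (cos \o (fun u => th * u))) _ :=
  is_deriveZ _ (is_derive1_comp (is_derive_cos (th * x)) dth).
have dsin : is_derive x (1 : R) (b *: (sin \o (fun u => th * u))) _ :=
  is_deriveZ _ (is_derive1_comp (is_derive_sin (th * x)) dth).
by apply: is_derive_eq (is_deriveD dcos dsin) _; rewrite /GRing.scale /=; ring.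
Qed.

Variables (D : set int) (A : int -> R[i]) (th : int -> R).
Hypothesis sA : csummable D A.
Hypothesis sAth : csummable D (fun n => A n * (th n)%:C).

Let normM_th n x :
  normc ((0 +i* th n) * (A n * cis (th n * x))) = normc (A n * (th n)%:C).
Proof.
rewrite !normcM normc_cis mulr1 mulrC normcR; congr (_ * _).
by rewrite normcE_sqrt /= expr0n add0r sqrtr_sqr.
Qed.

Let scis x : csummable D (fun n => A n * cis (th n * x)).
Proof. by apply: le_csummable sA => n _; rewrite normcM normc_cis mulr1. Qed.

Let snorm : (\esum_(n in D) (`|normc (A n * (th n)%:C)|)%:E < +oo)%E.
Proof. by under eq_esum do rewrite ger0_norm ?normc_ge0//. Qed.

Let is_derive_part (p : R[i] -> R) x : (forall z, `|p z| <= normc z) ->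
  (forall n u, is_derive u (1 : R) (fun u => p (A n * cis (th n * u)))
     (p ((0 +i* th n) * (A n * cis (th n * u))))) ->
  is_derive x (1 : R) (fun u => rsum D (fun n => p (A n * cis (th n * u))))
    (rsum D (fun n => p ((0 +i* th n) * (A n * cis (th n * x))))).
Proof.
move=> p_le dp.
apply: (is_derive_rsum (f := fun n u => p (A n * cis (th n * u)))
  (df := fun n u => p ((0 +i* th n) * (A n * cis (th n * u))))
  (M := fun n => normc (A n * (th n)%:C)) x _ _ snorm) => [n u _|u].
  by rewrite -(normM_th n u) p_le.
by apply: le_lt_trans (scis u); apply: le_esum => n _; rewrite lee_fin p_le.
Qed.

Lemma is_Cderive_csum_cis x :
  is_Cderive x (fun u => csum D (fun n => A n * cis (th n * u)))
    (csum D (fun n => (0 +i* th n) * (A n * cis (th n * x)))).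
Proof.
split.
  apply: is_derive_part => [z|n u]; first exact: ler_Re_normc.
  rewrite (_ : (fun u => _) = fun u => complex.Re (A n) * cos (th n * u) +
    - complex.Im (A n) * sin (th n * u)); last by apply/funext => v; rewrite ReMc mulNr.
  by apply: is_derive_eq (is_derive_cosDsin _ _ _ _) _; rewrite ReMc ImMc /=; ring.
apply: is_derive_part => [z|n u]; first exact: ler_Im_normc.
rewrite (_ : (fun u => _) = fun u => complex.Im (A n) * cos (th n * u) +
  complex.Re (A n) * sin (th n * u)); last by apply/funext => v; rewrite ImMc addrC.
by apply: is_derive_eq (is_derive_cosDsin _ _ _ _) _; rewrite ImMc ReMc /=; ring.
Qed.

End horizontal_derivative.

(** * Expansions on the upper half-plane *)

Section decay.
Context {R : realType}.

Lemma norm_le_expR (e L x : R) : 0 < e -> 0 <= L -> - L <= x ->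
  `|x| <= expR (2 * L * e) / e * expR (x * e).
Proof.
move=> e0 L0 Lx; rewrite mulrAC -expRD ler_pdivlMr//.
apply: (@le_trans _ _ ((x + 2 * L) * e)).
  by rewrite ler_wpM2r ?(ltW e0)// ler_norml; apply/andP; split; lra.
rewrite (_ : 2 * L * e + x * e = (x + 2 * L) * e); last by ring.
by apply: le_trans (expR_ge1Dx _); rewrite lerDr.
Qed.

(* Halving the height gains a factor exponentially small in [x n], which absorbs the
   polynomial factor [x n]. *)
Lemma csummable_mul_decay (D : set int) (c : int -> R[i]) (w : int -> R -> R)
    (x : int -> R) (C L : R) : 0 <= L ->
  (forall n y, 0 <= w n y) -> (forall n, D n -> c n != 0 -> - L <= x n) ->
  (forall n y, D n -> 0 < y -> w n y <= C * expR (- (x n * (y / 2))) * w n (y / 2)) ->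
  (forall y, 0 < y -> csummable D (fun n => c n * (w n y)%:C)) ->
  forall y, 0 < y -> csummable D (fun n => c n * (w n y)%:C * (x n)%:C).
Proof.
move=> L0 w0 xL wC sc y y0; have e0 : 0 < y / 2 by rewrite divr_gt0.
pose K := C * (expR (2 * L * (y / 2)) / (y / 2)).
apply: le_csummable (csummableZ K%:C (sc _ e0)) => n Dn.
have [->|c0] := eqVneq (c n) 0; first by rewrite !mul0r mulr0.
rewrite !normcM !normcR !(ger0_norm (w0 _ _)) -[leLHS]mulrA [leRHS]mulrCA.
rewrite ler_wpM2l ?normc_ge0//.
apply: (@le_trans _ _ (C * expR (- (x n * (y / 2))) * w n (y / 2) *
    (expR (2 * L * (y / 2)) / (y / 2) * expR (x n * (y / 2))))).
  by rewrite ler_pM// ?wC// norm_le_expR// xL.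
rewrite [leLHS](_ : _ = K * w n (y / 2) *
    (expR (- (x n * (y / 2))) * expR (x n * (y / 2)))).
  by rewrite -expRD addNr expR0 mulr1 ler_wpM2r// ler_norm.
by rewrite /K; ring.
Qed.

End decay.

Lemma axis_integral_componentwise {R : realType} {m : nat} (f : R[i] -> 'rV[R[i]]_m)
    (phi : R -> R[i]) (L : 'rV[R[i]]_m) :
  (forall j, let fphi y := f (0 +i* y) ord0 j * phi y in
     Cintegrable lebesgue_measure (@posreal R) fphi /\
     L ord0 j = Cintegral lebesgue_measure (@posreal R) fphi) ->
  axis_integrable f phi /\ L = axis_integral f phi.
Proof.
move=> axis; split=> [j|]; first by apply/cintegrableP; case: (axis j).
by apply/rowP => j; rewrite (axis j).2 mxE.
Qed.

Section expansion.
Context {R : realType} {m : nat}.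
Variables (k : R) (kap : 'I_m -> R).
Implicit Types (cp cm c : 'I_m -> int -> R[i]) (f : R[i] -> 'rV[R[i]]_m).
Implicit Types (phi : R -> R[i]) (j : 'I_m).
Local Notation mu := (@lebesgue_measure R).
Local Notation E := (@posreal R).
Local Notation angfreq j n := (2 * pi * freq (kap j) n).

Definition expansion cp cm (tau : R[i]) : 'rV[R[i]]_m :=
  \row_j (csum setT (plus_term kap cp j tau)
          + csum (negfreq (kap j)) (minus_term k kap cm j tau)).

Definition mul_freq c j n : R[i] := c j n * (freq (kap j) n)%:C.

Lemma cexp_angfreq (th u y : R) : cexp ((0 +i* 1) * th%:C * (u +i* y)) =
  (expR (- (th * y)))%:C * cis (th * u).
Proof.
have -> : (0 +i* 1) * th%:C * (u +i* y) = (- (th * y)) +i* (th * u).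
  by apply: eq_ReIm => /=; ring.
by apply: eq_ReIm; rewrite ?ReMc ?ImMc /= mul0r ?subr0 ?addr0.
Qed.

Lemma plus_termE cp j u y n : plus_term kap cp j (u +i* y) n =
  cp j n * (expR (- (angfreq j n * y)))%:C * cis (angfreq j n * u).
Proof. by rewrite /plus_term cexp_angfreq mulrA. Qed.

Lemma minus_termE cm j u y n : minus_term k kap cm j (u +i* y) n =
  cm j n * (gamma_weight k (- angfreq j n) y)%:C * cis (angfreq j n * u).
Proof.
rewrite /minus_term cexp_angfreq /gamma_weight [in RHS]rmorphM.
rewrite [in RHS]mulrA [LHS]mulrA mulNr; congr (_ * _%:C * _ * _).
by congr inc_gamma; rewrite /=; ring.
Qed.

Lemma negfreq_gt0 j n : negfreq (kap j) n -> 0 < - angfreq j n.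
Proof. by move=> Dn; rewrite oppr_gt0 pmulr_rlt0// mulr_gt0 ?pi_gt0. Qed.

Section has_expansion.
Variables (cp cm : 'I_m -> int -> R[i]) (f : R[i] -> 'rV[R[i]]_m).
Hypothesis hf : has_expansion k kap cp cm f.

Lemma has_expansionE tau : 0 < complex.Im tau -> f tau = expansion cp cm tau.
Proof. by move=> /hf.2[]. Qed.

Lemma has_expansion_axisE j y : 0 < y -> f (0 +i* y) ord0 j =
  csum setT (fun n => cp j n * (expR (- (angfreq j n * y)))%:C) +
  csum (negfreq (kap j)) (fun n => cm j n * (gamma_weight k (- angfreq j n) y)%:C).
Proof.
move=> y0; rewrite has_expansionE// mxE; apply: (congr2 +%R); apply: eq_csum => n _.
  by rewrite plus_termE mulr0 cis0 mulr1.
by rewrite minus_termE mulr0 cis0 mulr1.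
Qed.

Lemma csummable_plus_axis j y : 0 < y ->
  csummable setT (fun n => cp j n * (expR (- (angfreq j n * y)))%:C).
Proof.
move=> y0; have [/(_ j)[+ _] _] := hf.2 (0 +i* y) y0.
by apply: le_csummable => n _; rewrite plus_termE [leRHS]normcM normc_cis mulr1.
Qed.

Lemma csummable_minus_axis j y : 0 < y ->
  csummable (negfreq (kap j)) (fun n => cm j n * (gamma_weight k (- angfreq j n) y)%:C).
Proof.
move=> y0; have [/(_ j)[_ +] _] := hf.2 (0 +i* y) y0.
by apply: le_csummable => n _; rewrite minus_termE [leRHS]normcM normc_cis mulr1.
Qed.

Lemma csummable_plus_angfreq j y : 0 < y -> csummable setT
  (fun n => cp j n * (expR (- (angfreq j n * y)))%:C * (angfreq j n)%:C).
Proof.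
have [N cpN] := hf.1; pose L := `|angfreq j N|.
apply: (@csummable_mul_decay _ setT (cp j) (fun n y => expR (- (angfreq j n * y)))
  (fun n => angfreq j n) 1 L) => [||n _ cn|n z _ z0|z z0]; rewrite ?normr_ge0//.
- have Nn : N <= n by rewrite leNgt; apply: contra_neqN cn; exact: cpN.
  apply: (@le_trans _ _ (angfreq j N)); first exact: lerNnormlW.
  by rewrite ler_wpM2l ?mulr_ge0 ?pi_ge0// /freq lerD2r ler_int.
- by rewrite mul1r -expRD ler_expR; lra.
- exact: csummable_plus_axis.
Qed.

Lemma csummable_minus_angfreq j y : 0 < y -> csummable (negfreq (kap j))
  (fun n => cm j n * (gamma_weight k (- angfreq j n) y)%:C * (angfreq j n)%:C).
Proof.
move=> y0; have : csummable (negfreq (kap j))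
    (fun n => cm j n * (gamma_weight k (- angfreq j n) y)%:C * (- angfreq j n)%:C).
  apply: (@csummable_mul_decay _ _ (cm j) (fun n y => gamma_weight k (- angfreq j n) y)
    (fun n => - angfreq j n) (2 `^ (1 - k)) 0) y0 => [||n Dn _|n z Dn z0|z z0] //.
  - by move=> n z; exact: gamma_weight_ge0.
  - by rewrite oppr0 ltW// negfreq_gt0.
  - exact: gamma_weight_half (negfreq_gt0 Dn) z0.
  - exact: csummable_minus_axis.
by apply: le_csummable => n _; rewrite [leLHS]normcM [leRHS]normcM !normcR normrN.
Qed.

Let ler_norm_angfreq j n : `|freq (kap j) n| <= `|angfreq j n|.
Proof.
rewrite [leRHS]normrM ler_peMl// ger0_norm ?mulr_ge0 ?pi_ge0//.
by have := pi_ge2 R; lra.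
Qed.

Lemma has_expansion_mul_freq : has_expansion k kap (mul_freq cp) (mul_freq cm)
  (expansion (mul_freq cp) (mul_freq cm)).
Proof.
split.
  by have [N cpN] := hf.1; exists N => j n nN; rewrite /mul_freq cpN// mul0r.
case=> u y /= y0; split => // j; split.
  apply: le_csummable (csummable_plus_angfreq j y0) => n _.
  rewrite plus_termE [leLHS]normcM normc_cis mulr1 !normcM !normcR.
  by rewrite mulrAC ler_wpM2l ?ler_norm_angfreq ?mulr_ge0 ?normc_ge0.
apply: le_csummable (csummable_minus_angfreq j y0) => n _.
rewrite minus_termE [leLHS]normcM normc_cis mulr1 !normcM !normcR.
by rewrite mulrAC ler_wpM2l ?ler_norm_angfreq ?mulr_ge0 ?normc_ge0.
Qed.

Lemma partial_uE tau : 0 < complex.Im tau ->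
  partial_u f tau = (0 +i* (2 * pi)) *: expansion (mul_freq cp) (mul_freq cm) tau.
Proof.
case: tau => u y /= y0; apply/rowP => j; rewrite !mxE /=.
have [/(_ j)[sp sm] _] := has_expansion_mul_freq.2 (u +i* y) y0.
have dp := is_Cderive_csum_cis (csummable_plus_axis j y0) (csummable_plus_angfreq j y0) u.
have dm := is_Cderive_csum_cis (csummable_minus_axis j y0) (csummable_minus_angfreq j y0) u.
have fE v : f (v +i* y) ord0 j =
    csum setT (fun n => cp j n * (expR (- (angfreq j n * y)))%:C * cis (angfreq j n * v)) +
    csum (negfreq (kap j)) (fun n =>
      cm j n * (gamma_weight k (- angfreq j n) y)%:C * cis (angfreq j n * v)).
  rewrite has_expansionE// mxE; congr (_ + _); apply: eq_csum => n _.
    by rewrite plus_termE.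
  by rewrite minus_termE.
have [dr di] : is_Cderive u (fun v => f (v +i* y) ord0 j)
    (csum setT (fun n => (0 +i* angfreq j n) * (cp j n *
       (expR (- (angfreq j n * y)))%:C * cis (angfreq j n * u))) +
     csum (negfreq (kap j)) (fun n => (0 +i* angfreq j n) * (cm j n *
       (gamma_weight k (- angfreq j n) y)%:C * cis (angfreq j n * u)))).
  have -> : (fun v => f (v +i* y) ord0 j) = _ := funext fE; exact: is_CderiveD.
rewrite !derive1E (@derive_val _ _ _ _ _ _ _ dr) (@derive_val _ _ _ _ _ _ _ di).
have angfreqE n : 0 +i* angfreq j n = (0 +i* (2 * pi)) * (freq (kap j) n)%:C.
  by apply: eq_ReIm => /=; ring.
rewrite complex_eta [RHS]mulrDr -!csumZ//; apply: (congr2 +%R); apply: eq_csum => n _.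
  by rewrite plus_termE /mul_freq angfreqE; ring.
by rewrite minus_termE /mul_freq angfreqE; ring.
Qed.

End has_expansion.

(* Condition (iii) of [F_f] asks that this be finite. *)
Definition expansion_norm cp cm phi j : \bar R :=
  (\esum_(n in [set: int])
      ((normc (cp j n))%:E * laplace_norm phi (angfreq j n))
   + \esum_(n in negfreq (kap j))
      ((normc (cm j n) * (4 * pi * `|freq (kap j) n|) `^ (1 - k))%R%:E *
       \int[mu]_(t in E)
         (laplace_norm (twist phi (2 - k)) (- (angfreq j n * (2 * t + 1)))
          * (((1 + t) `^ k)^-1)%R%:E)))%E.

Lemma expansion_norm_lty cp cm phi j : (expansion_norm cp cm phi j < +oo)%E ->
  (\esum_(n in [set: int])
      ((normc (cp j n))%:E * laplace_norm phi (angfreq j n)) < +oo)%E /\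
  (\esum_(n in negfreq (kap j))
      ((normc (cm j n) * (2 * - angfreq j n) `^ (1 - k))%:E *
       \int[mu]_(t in E) gamma_laplace_norm k (- angfreq j n) phi t) < +oo)%E.
Proof.
move=> phi_lty; split; apply: le_lt_trans phi_lty.
  rewrite leeDl//; apply: esum_ge0 => n _; apply: mule_ge0.
    by rewrite lee_fin mulr_ge0 ?normc_ge0 ?powR_ge0.
  apply: integral_ge0 => t _; apply: mule_ge0; first exact: laplace_norm_ge0.
  by rewrite lee_fin invr_ge0 powR_ge0.
apply: le_trans (leeDr _ _); last first.
  apply: esum_ge0 => n _; apply: mule_ge0; first by rewrite lee_fin normc_ge0.
  exact: laplace_norm_ge0.
apply: le_esum => n Dn.
have -> : 4 * pi * `|freq (kap j) n| = 2 * - angfreq j n.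
  by rewrite ler0_norm ?(ltW Dn)//; ring.
by rewrite /gamma_laplace_norm; under eq_integral do rewrite mulNr.
Qed.

Lemma L_fE cp cm phi j : L_f k kap cp cm phi ord0 j =
  csum setT (fun n => cp j n * laplace phi (angfreq j n)%:C) +
  csum (negfreq (kap j)) (fun n => cm j n * ((2 * - angfreq j n) `^ (1 - k))%:C *
    Cintegral mu E (gamma_laplace k (- angfreq j n) phi)).
Proof.
rewrite mxE; apply: (congr2 +%R); apply: eq_csum => n _; first by [].
have -> : - (4 * pi * freq (kap j) n) = 2 * - angfreq j n by ring.
apply: (congr1 (GRing.mul _)); apply: eq_Cintegral => t _.
by rewrite /gamma_laplace mulNr.
Qed.

Lemma axis_integral_expansion cp cm f phi : has_expansion k kap cp cm f ->
  cmeasurable E phi ->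
  (forall s : R, 0 < s -> laplace_abscvg (twist phi (2 - k)) s%:C) ->
  (forall j, expansion_norm cp cm phi j < +oo)%E ->
  axis_integrable f phi /\ L_f k kap cp cm phi = axis_integral f phi.
Proof.
move=> hf mphi lphi phi_lty.
apply: axis_integral_componentwise => j fphi.
have [plus_lty minus_lty] := expansion_norm_lty (phi_lty j).
have sp y : E y -> csummable setT (fun n => cp j n * (expR (- (angfreq j n * y)))%:C).
  by move=> /posrealP; exact: csummable_plus_axis hf j y.
have sm y : E y -> csummable (negfreq (kap j))
    (fun n => cm j n * (gamma_weight k (- angfreq j n) y)%:C).
  by move=> /posrealP; exact: csummable_minus_axis hf j y.
have [intp intpE] := Cintegral_csum_expR mphi plus_lty sp.
have [intm intmE] := Cintegral_csum_gamma_weight mphi (@negfreq_gt0 j) lphi minus_lty sm.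
have fE y : E y ->
    csum setT (fun n => cp j n * (expR (- (angfreq j n * y)))%:C) * phi y +
    csum (negfreq (kap j)) (fun n => cm j n * (gamma_weight k (- angfreq j n) y)%:C) *
      phi y = fphi y.
  by move=> /posrealP y0; rewrite /fphi (has_expansion_axisE hf)// [RHS]mulrDl.
split.
  exact: (eq_Cintegrable measurable_posreal fE (CintegrableD measurable_posreal intp intm)).
rewrite L_fE -(eq_Cintegral mu fE) -intpE -intmE.
exact: esym (CintegralD measurable_posreal intp intm).
Qed.

Let twist_3Bk phi x : 0 < x -> twist phi (3 - k) x = twist (twist phi 2) (2 - k) x.
Proof. by move=> x0; rewrite twist_twist//; congr twist; ring. Qed.

Lemma L_deltaE cp cm phi : L_delta k kap cp cm phi =
  (k / 2)%:C *: L_f k kap cp cm phi -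
  (2 * pi)%:C *: L_f k kap (mul_freq cp) (mul_freq cm) (twist phi 2).
Proof.
rewrite /L_delta -addrA -opprD -scalerDr; congr (_ - _ *: _).
apply/rowP => j; rewrite !mxE; apply: (congr2 +%R); first by [].
apply: eq_csum => n _; apply: (congr1 (GRing.mul _)).
apply: eq_Cintegral => t _; apply: (congr1 (GRing.mul ^~ _)).
by apply: eq_laplace => x; exact: twist_3Bk.
Qed.

Lemma delta_axisE cp cm f phi j y : has_expansion k kap cp cm f -> 0 < y ->
  delta k f (0 +i* y) ord0 j * phi y =
  (k / 2)%:C * (f (0 +i* y) ord0 j * phi y) +
  (- (2 * pi))%:C *
    (expansion (mul_freq cp) (mul_freq cm) (0 +i* y) ord0 j * twist phi 2 y).
Proof.
move=> hf y0; rewrite /delta (partial_uE hf)//; set g := expansion _ _ _.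
have mul_ii : (0 +i* y) * (0 +i* (2 * pi)) = (- (2 * pi))%:C * y%:C.
  by apply: eq_ReIm => /=; ring.
by rewrite !mxE twist2E// mulrA mul_ii; ring.
Qed.

Lemma expansion_norm_mul_freq_lty n0 cp cm phi : F_delta k kap n0 cp cm phi ->
  forall j, (expansion_norm (mul_freq cp) (mul_freq cm) (twist phi 2) j < +oo)%E.
Proof.
move=> [_ _ _ phi_lty] j; move: (phi_lty j).
suff -> : laplace_norm (twist phi (3 - k)) = laplace_norm (twist (twist phi 2) (2 - k)).
  exact.
by apply/funext => s; apply: eq_laplace_norm => x; exact: twist_3Bk.
Qed.

Lemma axis_integral_delta cp cm f phi : has_expansion k kap cp cm f ->
  cmeasurable E phi ->
  (forall s : R, 0 < s -> laplace_abscvg (twist phi (3 - k)) s%:C) ->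
  (forall j, expansion_norm (mul_freq cp) (mul_freq cm) (twist phi 2) j < +oo)%E ->
  (k != 0 -> axis_integrable f phi /\ L_f k kap cp cm phi = axis_integral f phi) ->
  axis_integrable (delta k f) phi /\
  L_delta k kap cp cm phi = axis_integral (delta k f) phi.
Proof.
move=> hf mphi lphi phi_lty axisf.
have lphi2 (s : R) : 0 < s -> laplace_abscvg (twist (twist phi 2) (2 - k)) s%:C.
  by move=> s0; apply: (eq_laplace_abscvg (@twist_3Bk phi)); exact: lphi.
have [intg L_gE] := axis_integral_expansion (has_expansion_mul_freq hf)
  (cmeasurable_twist 2 mphi) lphi2 phi_lty.
apply: axis_integral_componentwise => j fphi.
have intf : (k / 2)%:C != 0 :> R[i] ->
    Cintegrable mu E (fun y => f (0 +i* y) ord0 j * phi y).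
  move=> k20; apply/cintegrableP; apply: (axisf _).1.
  by apply: contra_neq k20 => ->; rewrite mul0r.
have half_L_fE : (k / 2)%:C * L_f k kap cp cm phi ord0 j =
    (k / 2)%:C * Cintegral mu E (fun y => f (0 +i* y) ord0 j * phi y).
  by have [->|/axisf[_ ->]] := eqVneq k 0; rewrite ?mxE// !mul0r.
have /cintegrableP intgj := intg j.
have intf' := CintegrableZl_neq0 measurable_posreal intf.
have intg' := CintegrableZl (- (2 * pi))%:C measurable_posreal intgj.
have deltaE y : E y -> _ = fphi y :=
  fun Ey => esym (delta_axisE phi j hf ((posrealP y).1 Ey)).
split.
  exact: (eq_Cintegrable measurable_posreal deltaE
    (CintegrableD measurable_posreal intf' intg')).
rewrite -(eq_Cintegral mu deltaE) (CintegralD measurable_posreal intf' intg').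
rewrite (CintegralZl_neq0 measurable_posreal intf) (CintegralZl _ measurable_posreal intgj).
by rewrite L_deltaE L_gE mxE [X in X + _]mxE half_L_fE !mxE rmorphN mulNr.
Qed.

End expansion.

Theorem theorem3p1 (R : realType) (m : nat) (k : R)
  (hk : exists l : int, k = l%:~R / 2)
  (kap : 'I_m -> R) (hkap : forall j : 'I_m, 0 <= kap j < 1)
  (cp cm : 'I_m -> int -> R[i])
  (f : R[i] -> 'rV[R[i]]_m) (hf : has_expansion k kap cp cm f)
  (n0 : nat) (hn0 : growth_bound n0 f) :
  (forall phi : R -> R[i], F_f k kap n0 cp cm phi ->
     axis_integrable f phi /\
     L_f k kap cp cm phi = axis_integral f phi) /\
  (forall phi : R -> R[i], F_delta k kap n0 cp cm phi ->
     (k != 0 -> F_f k kap n0 cp cm phi) ->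
     axis_integrable (delta k f) phi /\
     L_delta k kap cp cm phi = axis_integral (delta k f) phi).
Proof.
have mphi (phi : R -> R[i]) :
    (forall s, - (2 * pi * n0%:R) <= complex.Re s -> laplace_abscvg phi s) ->
    cmeasurable (@posreal R) phi.
  move=> abs; apply/laplace_abscvg0_cmeasurable/abs.
  by rewrite oppr_le0 !mulr_ge0 ?pi_ge0.
have axis_f phi : F_f k kap n0 cp cm phi ->
    axis_integrable f phi /\ L_f k kap cp cm phi = axis_integral f phi.
  move=> [_ abs1 abs2 phi_lty]; apply: axis_integral_expansion hf _ _ phi_lty.
    exact: mphi abs1.
  by move=> s s0; exact: abs2.
split=> [//|phi hphi hphi_f]; have [_ abs1 abs2 _] := hphi.
apply: axis_integral_delta hf _ _ (expansion_norm_mul_freq_lty hphi) _.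
- exact: mphi abs1.
- by move=> s s0; exact: abs2.
- by move=> /hphi_f; exact: axis_f.
Qed.
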